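(* Let $\nu>-1/2$ and $p_0=\frac{4(\nu+1)}{2\nu+3+2\delta}$. If $0<\delta<\nu+1/2$, there is $C>0$ such that for all sufficiently large $R$, $$\sup_{E\subset(0,1)}\frac{\|\mathcal{B}_R^\delta\chi_E\|_{L^{p_0}((0,1),d\mu_\nu)}}{\|\chi_E\|_{L^{p_0}((0,1),d\mu_\nu)}}\ge C(\log R)^{1/p_0},$$ the supremum being over measurable $E$ with $\mu_\nu(E)>0$; and if $\delta=\nu+1/2$, there is $C>0$ such that for all sufficiently large $R$, $$\sup_{\|f\|_{L^{1}((0,1),d\mu_\nu)}=1}\|\mathcal{B}_R^\delta f\|_{L^{1}((0,1),d\mu_\nu)}\ge C\log R.$$
   Context: Let $J_\nu$ be the Bessel function of order $\nu$, $0<s_1<s_2<\dots$ its successive positive zeros, $d\mu_\nu(x)=x^{2\nu+1}dx$ on $(0,1)$, $\psi_j(x)=\frac{\sqrt2}{|J_{\nu+1}(s_j)|}x^{-\nu}J_\nu(s_jx)$, $a_j(f)=\int_0^1 f\psi_j\,d\mu_\nu$. For $\delta>0$, $R>0$, $\mathcal{B}_R^\delta f(x)=\sum_{j\ge1}(1-s_j^2/R^2)_+^\delta a_j(f)\psi_j(x)$ with $(1-s^2)_+=\max\{1-s^2,0\}$. $\chi_E$ is the indicator of $E$. *)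

(* Defs.v *)
From HB Require Import structures.
From mathcomp Require Import all_boot all_order all_algebra.
From mathcomp Require Import all_classical all_reals all_analysis.
Set Implicit Arguments. Unset Strict Implicit. Unset Printing Implicit Defensive.
Import Order.TTheory GRing.Theory Num.Theory.
Import numFieldNormedType.Exports.
Local Open Scope classical_set_scope.
Local Open Scope ring_scope.

Section Bessel.
Context {R : realType}.
Local Notation leb := (@lebesgue_measure R).

Definition Gamma (s : R) : R :=
  fine (\int[leb]_(t in `]0%R, +oo[) ((t `^ (s - 1) * expR (- t))%:E))%E.

Definition besselJ (nu x : R) : R :=
  limn (fun n => \sum_(0 <= k < n) ((-1) ^+ k / ((k`!)%:R * Gamma (k%:R + nu + 1))
                      * (x / 2) `^ nu * (x / 2) ^+ (2 * k))).

(* s (indexed from 0: s 0 = s_1) enumerates the positive zeros of J_nu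
   in increasing order. *)
Definition bessel_zeros (nu : R) (s : nat -> R) : Prop :=
  [/\ forall j, 0 < s j,
      forall j, besselJ nu (s j) = 0,
      forall i j, (i < j)%N -> s i < s j &
      forall x, 0 < x -> besselJ nu x = 0 -> exists j, s j = x].

Definition wgt (nu x : R) : R := x `^ (2 * nu + 1).

Definition psi (nu : R) (s : nat -> R) (j : nat) (x : R) : R :=
  Num.sqrt 2 / `|besselJ (nu + 1) (s j)| * x `^ (- nu) * besselJ nu (s j * x).

Definition coef (nu : R) (s : nat -> R) (j : nat) (f : R -> R) : R :=
  fine (\int[leb]_(x in `]0%R, 1%R[) ((f x * psi nu s j x * wgt nu x)%:E))%E.

Definition bochner_riesz (nu : R) (s : nat -> R) (delta Rr : R)
    (f : R -> R) (x : R) : R :=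
  limn (fun n => \sum_(0 <= j < n) (Num.max (1 - s j ^+ 2 / Rr ^+ 2) 0 `^ delta
                       * coef nu s j f * psi nu s j x)).

Definition mu_nu (nu : R) (E : set R) : \bar R :=
  (\int[leb]_(x in E `&` `]0%R, 1%R[) (wgt nu x)%:E)%E.

Definition Lp_nu (nu p : R) (g : R -> R) : \bar R :=
  ((\int[leb]_(x in `]0%R, 1%R[) ((`|g x| `^ p * wgt nu x)%:E)) `^ p^-1)%E.

End Bessel.

(* Main.v *)
Require Import Defs.
From HB Require Import structures.
From mathcomp Require Import all_boot all_order all_algebra.
From mathcomp Require Import all_classical all_reals all_analysis.
From mathcomp Require Import measurable_realfun qpoly ring lra.
Set Implicit Arguments.
Unset Strict Implicit.
Unset Printing Implicit Defensive.
Import Order.TTheory GRing.Theory Num.Theory.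
Import numFieldNormedType.Exports.
Local Open Scope classical_set_scope.
Local Open Scope ring_scope.

(* The multiplier vanishes at the zeros [s_j >= R], and the [psi_j] are
   orthonormal.  For [E = (0, c/R)], [B_R chi_E] is therefore paired with test
   functions [g] that are finite combinations of the [psi_j]:
   [<B_R chi_E, g>] only sees the coefficients of [g] at zeros below [R].  For
   each dyadic [N] between a constant and [sqrt R], pick a zero [s_0] with
   [R - 2 N <= s_0 <= R - N] and zeros [s_1, ..., s_m >= R] with gaps comparable
   to [N] (Sturm comparison provides a zero in every long enough interval), and
   subtract from [x^-nu J_nu(s_0 x)] its Lagrange extrapolation in the variable
   [s^2] from the nodes [s_i^2].  With [m > delta], the difference is
   [O(min(1, (N x)^m) (1 + R x)^(-nu-1/2))], so its sum over [N] with weights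
   [N^-delta] is
   [O(x^delta (1 + R x)^(-nu-1/2)) = O(R^-delta (1 + R x)^(-(nu+1/2-delta)))],
   while each [N] contributes at least
   [N^-delta (N/R)^delta mu(E) = R^-delta mu(E)] to the pairing, that is
   [R^-delta mu(E) log R] in total.  Since
   [nu + 1/2 - delta = (p_0 - 1) (nu + 3/2 + delta)], Young's inequality against
   [(1 + R x)^-(nu + 3/2 + delta)], whose [p_0]-th power has integral
   [O(R^(-2nu-2) log R)], turns this into
   [||B_R chi_E||_{p_0}^{p_0} >= c mu(E) log R]. *)

(** * Calculus on the line and the Gamma function *)

Section Calculus.
Context {R : realType}.
Implicit Types (f g F : R -> R) (a b x y : R).
Local Notation leb := (@lebesgue_measure R).

Lemma is_derive_add f g x a b : is_derive x 1 f a -> is_derive x 1 g b ->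
  is_derive x 1 (fun y => f y + g y) (a + b).
Proof. by move=> df dg; apply: (@is_deriveD _ _ _ f g). Qed.

Lemma is_derive_sub f g x a b : is_derive x 1 f a -> is_derive x 1 g b ->
  is_derive x 1 (fun y => f y - g y) (a - b).
Proof. by move=> df dg; apply: (@is_deriveB _ _ _ f g). Qed.

Lemma is_derive_mul f g x a b : is_derive x 1 f a -> is_derive x 1 g b ->
  is_derive x 1 (fun y => f y * g y) (a * g x + f x * b).
Proof.
move=> df dg; apply: (is_derive_eq (is_deriveM df dg)).
by rewrite /GRing.scale/= addrC [g x * a]mulrC.
Qed.

Lemma is_derive_scale f c x a : is_derive x 1 f a ->
  is_derive x 1 (fun y => c * f y) (c * a).
Proof.
move=> df; have := is_derive_mul (is_derive_cst c x 1) df.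
by rewrite mul0r add0r.
Qed.

Lemma is_derive_comp f g x a b : is_derive (g x) 1 f a -> is_derive x 1 g b ->
  is_derive x 1 (fun y => f (g y)) (a * b).
Proof. by move=> df dg; apply: (@is_derive1_comp _ f g). Qed.

Lemma is_derive_continuous {f x a} : is_derive x 1 f a -> {for x, continuous f}.
Proof. by move=> df; apply/differentiable_continuous/derivable1_diffP. Qed.

Lemma continuous_addf f g : continuous f -> continuous g ->
  continuous (fun x => f x + g x).
Proof. by move=> cf cg x; apply: cvgD; [exact: cf|exact: cg]. Qed.

Lemma continuous_subf f g : continuous f -> continuous g ->
  continuous (fun x => f x - g x).
Proof. by move=> cf cg x; apply: cvgB; [exact: cf|exact: cg]. Qed.

Lemma continuous_mulf f g : continuous f -> continuous g ->
  continuous (fun x => f x * g x).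
Proof. by move=> cf cg x; apply: cvgM; [exact: cf|exact: cg]. Qed.

Lemma continuous_scalef (c : R) f : continuous f -> continuous (fun x => c * f x).
Proof. by move=> cf x; apply: cvgM; [exact: cvg_cst|exact: cf]. Qed.

Lemma continuous_sumf (I : Type) (r : seq I) (P : pred I) (h : I -> R -> R) :
  (forall i, continuous (h i)) ->
  continuous (fun x => \sum_(i <- r | P i) h i x).
Proof.
move=> ch x; elim: r => [|i r IH].
  by under eq_fun do rewrite big_nil; exact: cvg_cst.
rewrite /continuous_at big_cons; under eq_fun do rewrite big_cons.
by case: (P i) => //; apply: cvgD => //; exact: ch.
Qed.

Lemma MVT_le f (f' : R -> R) a b : a <= b ->
  (forall x, a <= x <= b -> is_derive x 1 f (f' x)) ->
  exists2 c, a <= c <= b & f b - f a = f' c * (b - a).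
Proof.
move=> ab df; have [||c cab ->] := @MVT_segment _ f f' a b ab.
- by move=> x; rewrite in_itv/= => /andP[ax xb]; apply: df; rewrite !ltW.
- apply: derivable_within_continuous => x; rewrite in_itv/= => /df dfx.
  exact: ex_derive.
- by exists c => //; rewrite in_itv/= in cab.
Qed.

Lemma derive_le0_nonincreasing f (f' : R -> R) a b : a <= b ->
  (forall x, a <= x <= b -> is_derive x 1 f (f' x)) ->
  (forall x, a <= x <= b -> f' x <= 0) -> f b <= f a.
Proof.
move=> ab df f'0; have [c cab e] := MVT_le ab df.
by rewrite -subr_le0 e mulr_le0_ge0 ?subr_ge0// f'0.
Qed.

(** The endpoints are unordered so that a Taylor remainder can be estimated on either side of its
    center. *)
Lemma derive_bound f (f' : R -> R) a b M :
  (forall x, Num.min a b <= x <= Num.max a b -> is_derive x 1 f (f' x)) ->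
  (forall x, Num.min a b <= x <= Num.max a b -> `|f' x| <= M) ->
  `|f b - f a| <= M * `|b - a|.
Proof.
wlog ab : a b / a <= b.
  move=> H df fM; have [ab|/ltW ba] := leP a b; first exact: H.
  rewrite distrC [X in _ * X]distrC; apply: H => // x.
    by rewrite minC maxC; apply: df.
  by rewrite minC maxC; apply: fM.
rewrite min_l// max_r// => df fM.
have [c cab ->] := MVT_le ab df.
by rewrite normrM ler_wpM2r// fM.
Qed.

Lemma continuous_integrable_oo f a b : continuous f ->
  leb.-integrable `]a, b[ (EFin \o f).
Proof.
move=> cf; apply: (@integrableS _ _ _ leb `[a, b]) => //.
  exact: subset_itv_oo_cc.
apply: continuous_compact_integrable; first exact: segment_compact.
exact: continuous_subspaceT.
Qed.

(** The antiderivatives used later contain [|x|^(2 nu + 1)], which need not be differentiable at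
    [0]; hence derivatives are asked only inside the interval. *)
Lemma continuous_FTC2_oo f F a b : a < b ->
  (forall x, a <= x <= b -> {for x, continuous f}) ->
  (forall x, a <= x <= b -> {for x, continuous F}) ->
  (forall x, a < x < b -> is_derive x 1 F (f x)) ->
  \int[leb]_(x in `]a, b[) f x = F b - F a.
Proof.
move=> ab cf cF dF.
have wf g : (forall x, a <= x <= b -> {for x, continuous g}) ->
    {within `[a, b], continuous g}.
  move=> cg; apply: continuous_in_subspaceT => x.
  by rewrite inE/= in_itv/=; exact: cg.
have mf A : measurable A -> A `<=` `[a, b] -> measurable_fun A (EFin \o f).
  move=> mA sA; apply/measurable_EFinP.
  apply: (measurable_funS _ sA) => //.
  by apply: subspace_continuous_measurable_fun => //; exact: wf.
rewrite /Rintegral integral_itv_bndo_bndc; last first.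
  by apply: mf => //; exact: subset_itv_oo_cc.
rewrite integral_itv_obnd_cbnd; last first.
  by apply: mf => //; exact: subset_itv_oc_cc.
rewrite (@continuous_FTC2 _ f F)//.
- exact: wf.
- split.
  + by move=> x; rewrite in_itv/= => /dF H; apply: ex_derive.
  + by apply/cvg_at_right_filter/cF; rewrite lexx ltW.
  + by apply/cvg_at_left_filter/cF; rewrite lexx ltW.
- by move=> x; rewrite in_itv/= => /dF H; rewrite derive1E; apply: derive_val.
Qed.

Lemma continuous_powR_gt0 (a x : R) : 0 < x -> {for x, continuous (fun t : R => t `^ a)}.
Proof. by move=> x0; exact: (is_derive_continuous (is_derive1_powR a x0)). Qed.

Lemma is_derive_powR (a x : R) : 0 < x ->
  is_derive x 1 (fun t : R => t `^ a) (a * x `^ a / x).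
Proof.
move=> x0; apply: (is_derive_eq (is_derive1_powR a x0)).
by rewrite powRB ?(lt0r_neq0 x0) ?implybT// powRr1 ?ltW// mulrA.
Qed.

Lemma is_derive_expRM (c x : R) :
  is_derive x 1 (fun t => expR (c * t)) (c * expR (c * x)).
Proof.
have := is_derive_comp (is_derive_expR (c * x))
  (is_derive_scale c (is_derive_id x (1:R))).
by move=> H; apply: (is_derive_eq H); rewrite mulr1 mulrC.
Qed.

Lemma Rintegral_sum_oo (I : Type) (r : seq I) (P : pred I) (h : I -> R -> R) a b :
  (forall i, continuous (h i)) ->
  \int[leb]_(x in `]a, b[) (\sum_(i <- r | P i) h i x) =
  \sum_(i <- r | P i) \int[leb]_(x in `]a, b[) h i x.
Proof.
move=> ch; elim: r => [|i r IH].
  rewrite big_nil; under eq_Rintegral do rewrite big_nil.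
  by rewrite Rintegral_cst ?mul0r//; exact: measurable_itv.
rewrite big_cons; under eq_Rintegral do rewrite big_cons.
case: (P i) => //; rewrite RintegralD ?IH//; apply: continuous_integrable_oo => //.
exact: continuous_sumf.
Qed.

End Calculus.

(** * The Gamma function: finiteness, recurrence and positivity *)

Section GammaFunction.
Context {R : realType}.
Implicit Types s t : R.
Local Notation leb := (@lebesgue_measure R).

Let gam s t : R := t `^ (s - 1) * expR (- t).
(** These intervals exhaust the half-line while staying away from [0]; calculus is done on them and
    passed to the limit by monotone convergence. For [n = 0] the interval is empty, whence the
    shifts to [n.+1]. *)
Let itv_ (n : nat) : set R := `](n.+1%:R)^-1, n.+1%:R[%classic.

Let is_derive_expRN t : is_derive t 1 (fun t => expR (- t)) (- expR (- t)).
Proof.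
have := is_derive_expRM (-1) t.
rewrite mulN1r; under eq_fun do rewrite mulN1r.
by rewrite mulN1r.
Qed.

Let gam_continuous s t : 0 < t -> {for t, continuous (gam s)}.
Proof.
move=> t0; apply: (is_derive_continuous (is_derive_mul
  (is_derive_powR (s - 1) t0) (is_derive_expRN t))).
Qed.

Let gam_ge0 s t : 0 <= gam s t.
Proof. by rewrite mulr_ge0 ?powR_ge0 ?expR_ge0. Qed.

Let itv_nd : nondecreasing_seq itv_.
Proof.
apply/nondecreasing_seqP => n; rewrite subsetEset => x.
rewrite /itv_/= !in_itv/= => /andP[h1 h2]; apply/andP; split.
  by apply: le_lt_trans h1; rewrite lef_pV2 ?posrE// ler_nat.
by apply: lt_le_trans h2 _; rewrite ler_nat.
Qed.

Let itv_cup : \bigcup_n itv_ n = `]0%R, +oo[%classic.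
Proof.
apply/seteqP; split => x /=.
  move=> [n _]; rewrite /itv_/= !in_itv/= andbT => /andP[h _].
  by apply: lt_trans h; rewrite invr_gt0.
rewrite in_itv/= andbT => x0.
pose y := Num.max x x^-1.
have y0 : 0 <= y by rewrite le_max (ltW x0).
exists (Num.truncn y) => //; rewrite /itv_/= in_itv/=.
have := truncnS_gt y; rewrite /y gt_max => /andP[h1 h2]; rewrite h1 andbT.
by rewrite -[ltRHS]invrK ltf_pV2 ?posrE ?invr_gt0.
Qed.

Let meas_gam s : measurable_fun (`]0%R, +oo[ : set R) (EFin \o gam s).
Proof.
apply/measurable_EFinP; apply: open_continuous_measurable_fun.
  exact: interval_open.
move=> x.
by rewrite inE/= in_itv/= andbT; exact: gam_continuous.
Qed.

Let sub_itv n : itv_ n `<=` `]0%R, +oo[%classic.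
Proof. by rewrite -itv_cup; exact: bigcup_sup. Qed.

Let gam_cvg s : (\int[leb]_(t in itv_ n) (gam s t)%:E)%E @[n --> \oo] -->
  (\int[leb]_(t in `]0%R, +oo[) (gam s t)%:E)%E.
Proof.
rewrite -itv_cup; apply: ge0_nondecreasing_set_cvg_integral => //.
- by move=> n; exact: (measurable_itv _).
- move=> n; apply: measurable_funS (@sub_itv n) (meas_gam s) => //.
- by move=> n x _; rewrite lee_fin.
Qed.

Let itv_lt n : (0 < n)%N -> (n.+1%:R)^-1 < n.+1%:R :> R.
Proof.
move=> n0; apply: (@lt_trans _ _ 1); rewrite ?ltr1n//.
by rewrite invf_lt1// ltr1n.
Qed.

(** Half of the exponential absorbs the power: this is [ln u <= u - 1] at [u = t / (2 s)],
    multiplied by [s] and exponentiated. *)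
Let gam_bound s t : 0 < s -> 0 < t ->
  t `^ s * expR (- t) <= (2 * s) `^ s * expR (- 2^-1 * t).
Proof.
move=> s0 t0; rewrite /powR !gt_eqF ?mulr_gt0// -!expRD ler_expR.
have h : ln (t / (2 * s)) <= t / (2 * s) - 1.
  have := @le_ln1Dx _ (t / (2 * s) - 1).
  rewrite [1 + _]addrC subrK; apply.
  by rewrite ltrBDr addNr divr_gt0// mulr_gt0.
rewrite ln_div ?posrE ?mulr_gt0// in h.
have h2 : s * ln t <= s * (ln (2 * s) + t / (2 * s)).
  by rewrite ler_pM2l//; lra.
apply: (@le_trans _ _ (s * (ln (2 * s) + t / (2 * s)) - t)).
  by rewrite lerD2r.
rewrite mulrDr.
have -> : s * (t / (2 * s)) = t / 2 by field; lra.
lra.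
Qed.

Let gam_integrable s n : (0 < n)%N ->
  leb.-integrable (itv_ n) (EFin \o gam s).
Proof.
move=> n0; rewrite /itv_.
apply: (@integrableS _ _ _ leb (`[(n.+1%:R)^-1, n.+1%:R]%classic : set R)) => //.
  exact: subset_itv_oo_cc.
apply: continuous_compact_integrable; first exact: segment_compact.
apply: continuous_in_subspaceT => x; rewrite inE/= in_itv/= => /andP[h _].
by apply: gam_continuous; apply: lt_le_trans h; rewrite invr_gt0.
Qed.

Let gam_int s n : (0 < n)%N ->
  (\int[leb]_(t in itv_ n) (gam s t)%:E = (\int[leb]_(t in itv_ n) gam s t)%:E)%E.
Proof.
move=> n0; rewrite /Rintegral fineK//.
by apply: integrable_fin_num (gam_integrable s n0); exact: (measurable_itv _).
Qed.

Let gam_parts s n : (0 < n)%N ->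
  s * \int[leb]_(t in itv_ n) gam s t =
  \int[leb]_(t in itv_ n) gam (s + 1) t
  + (n.+1%:R `^ s * expR (- n.+1%:R) - n.+1%:R^-1 `^ s * expR (- n.+1%:R^-1)).
Proof.
move=> n0.
have pos x : (n.+1%:R)^-1 <= x -> 0 < x.
  by move=> h; apply: lt_le_trans h; rewrite invr_gt0.
have <- : \int[leb]_(t in itv_ n) (s * gam s t - gam (s + 1) t) =
    n.+1%:R `^ s * expR (- n.+1%:R) - n.+1%:R^-1 `^ s * expR (- n.+1%:R^-1).
  apply: (@continuous_FTC2_oo _ _ (fun t : R => t `^ s * expR (- t)) _ _
    (itv_lt n0)).
  - move=> x /andP[/pos x0 _]; apply: continuousB; last exact: gam_continuous.
    by apply: continuousM; [exact: cst_continuous | exact: gam_continuous].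
  - move=> x /andP[/pos x0 _]; apply: (is_derive_continuous (is_derive_mul
      (is_derive_powR s x0) (is_derive_expRN x))).
  - move=> x /andP[/ltW/pos x0 _].
    apply: (is_derive_eq (is_derive_mul
      (is_derive_powR s x0) (is_derive_expRN x))).
    rewrite /gam addrK powRB ?(lt0r_neq0 x0) ?implybT// powRr1 ?ltW//.
    by rewrite mulrN !mulrA.
have mi : measurable (itv_ n) by exact: (measurable_itv _).
have i1 := gam_integrable s n0; have i2 := gam_integrable (s + 1) n0.
rewrite RintegralB//; first by rewrite RintegralZl// addrCA subrr addr0.
exact: (@integrableZl _ _ _ leb (itv_ n) mi s (EFin \o gam s)).
Qed.

Let tail_le s n : 0 < s ->
  n.+1%:R `^ s * expR (- n.+1%:R) <= (2 * s) `^ s * expR (- 2^-1 * n.+1%:R).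
Proof. by move=> s0; apply: gam_bound. Qed.

Let tail_cvg s : 0 < s ->
  n.+1%:R `^ s * expR (- n.+1%:R) - n.+1%:R^-1 `^ s * expR (- n.+1%:R^-1)
    @[n --> \oo] --> (0 : R).
Proof.
move=> s0; rewrite -[X in _ --> X](subr0 (0 : R)); apply: cvgB.
  apply: (@squeeze_cvgr _ _ _ _ (fun=> 0)
    (fun n : nat => (2 * s) `^ s * (2 * n.+1%:R^-1))).
  - near=> n; rewrite mulr_ge0 ?powR_ge0 ?expR_ge0//=.
    apply: (le_trans (tail_le n s0)); rewrite ler_wpM2l ?powR_ge0//.
    rewrite mulNr expRN -[2 * _]invrK lef_pV2 ?posrE ?expR_gt0//.
    apply: le_trans (expR_ge1Dx _).
    by rewrite invfM invrK lerDr.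
  - exact: cvg_cst.
  - rewrite -[X in _ --> X](mulr0 ((2 * s) `^ s)); apply: cvgM.
      exact: cvg_cst.
    rewrite -[X in _ --> X](mulr0 2); apply: cvgM; first exact: cvg_cst.
    exact: cvg_harmonic.
apply: (@squeeze_cvgr _ _ _ _ (fun=> 0) (fun n : nat => n.+1%:R^-1 `^ s)).
- near=> n; rewrite mulr_ge0 ?powR_ge0 ?expR_ge0//=.
  by rewrite ler_piMr ?powR_ge0// expR_le1 oppr_le0.
- exact: cvg_cst.
- apply: (cvg_at_rightP _ _ _).1 (powR_cvg0 s0) _ _; split.
    by move=> n; rewrite invr_gt0.
  exact: cvg_harmonic.
Unshelve. all: by end_near. Qed.

Let I_ s n : R := \int[leb]_(t in itv_ n) gam s t.
Let S_ s : \bar R := (\int[leb]_(t in `]0%R, +oo[) (gam s t)%:E)%E.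

Let I_cvg s : (I_ s n.+1)%:E @[n --> \oo] --> S_ s.
Proof.
have := @gam_cvg s; rewrite -cvg_shiftS => h.
apply: cvg_trans h; apply: near_eq_cvg; near=> n.
exact: gam_int.
Unshelve. all: by end_near. Qed.

(** By [gam_bound] the integrand is at most a multiple of [exp (- t / 2)], whose integral over any
    of the intervals is at most [2]. *)
Let I_bound s n : 0 < s -> (0 < n)%N -> I_ (s + 1) n <= 2 * (2 * s) `^ s.
Proof.
move=> s0 n0; pose c : R := - 2^-1.
pose g t : R := c * expR (c * t).
have cE x : {for x, continuous g}.
  have := is_derive_scale c (is_derive_expRM c x).
  exact: is_derive_continuous.
have ig : leb.-integrable (itv_ n) (EFin \o g).
  exact: continuous_integrable_oo.
have mi : measurable (itv_ n) by exact: (measurable_itv _).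
apply: (@le_trans _ _
    (\int[leb]_(t in itv_ n) (- (2 * (2 * s) `^ s) * g t))).
  apply: le_Rintegral => //; first exact: gam_integrable.
    exact: (@integrableZl _ _ _ leb (itv_ n) mi _ (EFin \o g)).
  move=> x /sub_itv /=; rewrite in_itv/= andbT => x0.
  rewrite /gam addrK (le_trans (gam_bound s0 x0))// /g/c.
  have -> : - (2 * (2 * s) `^ s) * (- 2^-1 * expR (- 2^-1 * x)) =
    (2 * s) `^ s * expR (- 2^-1 * x) by field.
  by [].
rewrite RintegralZl//.
have -> : \int[leb]_(t in itv_ n) g t =
    expR (c * n.+1%:R) - expR (c * n.+1%:R^-1).
  apply: (@continuous_FTC2_oo _ _ (fun t : R => expR (c * t)) _ _ (itv_lt n0)).
  - by move=> x _; exact: cE.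
  - by move=> x _; exact: (is_derive_continuous (is_derive_expRM c x)).
  - by move=> x _; exact: is_derive_expRM.
rewrite mulNr -mulrN opprB ler_piMr// ?mulr_ge0 ?powR_ge0//.
rewrite lerBlDr (@le_trans _ _ 1) ?lerDl ?expR_ge0//.
by rewrite expR_le1 mulNr oppr_le0 mulr_ge0.
Qed.

Let I_fin s (l : R) : I_ s n.+1 @[n --> \oo] --> l -> S_ s = l%:E.
Proof.
move=> h; have h2 : (I_ s n.+1)%:E @[n --> \oo] --> l%:E.
  by apply/fine_cvgP; split; [exact: nearW|exact: h].
exact: (cvg_unique _ (@I_cvg s) h2).
Qed.

Let S_fin s : 0 < s -> S_ (s + 1) \is a fin_num.
Proof.
move=> s0; rewrite ge0_fin_numE; last first.
  by apply: integral_ge0 => x _; rewrite lee_fin.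
apply: (@le_lt_trans _ _ (2 * (2 * s) `^ s)%:E); last exact: ltry.
rewrite -(cvg_lim _ (@I_cvg (s + 1)))//.
apply: lime_le; first by apply/cvg_ex; exists (S_ (s + 1)); exact: I_cvg.
by near=> n; rewrite lee_fin; exact: I_bound.
Unshelve. all: by end_near. Qed.

(** Letting [n] tend to infinity in the integration by parts transfers finiteness from [s + 1] to
    [s]. This has to precede [Gamma_rec], because [fine] would send an infinite integral to [0]. *)
Let S_rec s : 0 < s -> S_ s = (s^-1 * Gamma (s + 1))%:E.
Proof.
move=> s0; apply: I_fin; have sN0 := lt0r_neq0 s0.
have h1 : I_ (s + 1) n.+1 @[n --> \oo] --> Gamma (s + 1).
  have := @I_cvg (s + 1); rewrite -[S_ _]fineK ?S_fin// => /fine_cvg.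
  exact.
rewrite -[Gamma _]addr0.
have -> : (fun n => I_ s n.+1) = (fun n => s^-1 * (I_ (s + 1) n.+1 +
    (n.+2%:R `^ s * expR (- n.+2%:R) - n.+2%:R^-1 `^ s * expR (- n.+2%:R^-1)))).
  by apply/funext => n; rewrite -gam_parts// mulKf.
apply: cvgM; first exact: cvg_cst.
apply: cvgD; first exact: h1.
by have := tail_cvg s0; rewrite -cvg_shiftS.
Qed.

Lemma Gamma_rec s : 0 < s -> Gamma (s + 1) = s * Gamma s.
Proof.
move=> s0; rewrite [in RHS]/Gamma -/(gam s) -/(S_ s) S_rec//=.
by rewrite mulVKf ?lt0r_neq0.
Qed.

Lemma Gamma_gt0 s : 0 < s -> 0 < Gamma s.
Proof.
move=> s0.
have cg : {within `[2^-1, 2], continuous (gam s)}.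
  apply: continuous_in_subspaceT => x; rewrite inE/= in_itv/= => /andP[+ _].
  by move=> /(lt_le_trans _) x0; apply: gam_continuous; apply: x0.
(* Positivity comes from []1/2, 2[] alone, where the integrand is at least its minimum over the
   closed interval. *)
have [c cab cm] := @EVT_min _ (gam s) 2^-1 2 ltac:(lra) cg.
have c0 : 0 < gam s c.
  rewrite mulr_gt0 ?expR_gt0// powR_gt0//.
  by move: cab; rewrite in_itv/= => /andP[+ _]; apply: lt_le_trans.
have mi n : measurable (itv_ n) by exact: (measurable_itv _).
have I0 : 0 < I_ s 1.
  apply: (@lt_le_trans _ _ (\int[leb]_(t in itv_ 1) gam s c)).
    have mu : fine (leb (itv_ 1)) = 2 - 2^-1.
      by rewrite lebesgue_measure_itv/= lte_fin itv_lt.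
    have -> : \int[leb]_(t in itv_ 1) gam s c = gam s c * (2 - 2^-1).
      by rewrite (Rintegral_cst leb (mi 1%N) (gam s c)) mu.
    by rewrite mulr_gt0// subr_gt0; lra.
  apply: le_Rintegral.
  - exact: mi.
  - by apply: continuous_integrable_oo => x; exact: cst_continuous.
  - exact: gam_integrable.
  - by move=> x; rewrite /itv_/= => xi; apply: cm; apply: subset_itv_oo_cc.
rewrite (lt_le_trans I0)// /Gamma -/(gam s) -/(S_ s) -lee_fin -gam_int//.
have Sf : S_ s \is a fin_num by rewrite S_rec.
rewrite fineK//.
apply: ge0_subset_integral.
- exact: mi.
- exact: (measurable_itv _).
- exact: meas_gam.
- by move=> x _; rewrite lee_fin.
- exact: sub_itv.
Qed.

End GammaFunction.

(** * Bessel series *)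

Section BesselSeries.
Context {R : realType}.
Implicit Types mu x y z : R.

Definition bessel_coeff mu : R^nat :=
  fun k => (-1) ^+ k / (k`!%:R * Gamma (k%:R + mu + 1)).

(** Up to the sign of the argument, the Bessel-Clifford function:
    [J_mu x = (x/2)^mu * Phi mu ((x/2)^2)]. In the variable [(x/2)^2], differentiation only raises
    the order and changes the sign. *)
Definition Phi mu y : R := limn (pseries (bessel_coeff mu) y).

(** Passing from [k] to [k + 1] multiplies by [k + mu + 1], which exceeds [1] once [k >= 1]; so the
    smaller of the first two values is a lower bound. *)
Lemma Gamma_nat_lower_bound mu : -1 < mu ->
  exists2 m : R, 0 < m & forall k, m <= Gamma (k%:R + mu + 1).
Proof.
move=> mu1; have mu10 : 0 < mu + 1 by lra.
have G (k : nat) : Gamma (k.+1%:R + mu + 1) =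
    (k%:R + mu + 1) * Gamma (k%:R + mu + 1).
  rewrite -Gamma_rec; first by rewrite -natr1; congr Gamma; ring.
  by rewrite -addrA ltr_wpDl.
exists (Num.min (Gamma (mu + 1)) (Gamma (1%:R + mu + 1))).
  by rewrite lt_min !Gamma_gt0//; lra.
elim=> [|[|k] IH]; first by rewrite add0r ge_min lexx.
  by rewrite ge_min lexx orbT.
apply: (le_trans IH); rewrite [leRHS]G ler_peMl ?(ltW (Gamma_gt0 _))//.
  by rewrite -addrA ltr_wpDl.
rewrite -natr1 -!addrA; have := ler0n R k; lra.
Qed.

Lemma pseries_bessel_cvg mu y : -1 < mu -> cvgn (pseries (bessel_coeff mu) y).
Proof.
move=> mu1; have [m m0 Gm] := Gamma_nat_lower_bound mu1.
apply: normed_cvg; rewrite /normed_series_of.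
apply: (@series_le_cvg _ _ (m^-1 *: exp_coeff `|y|)).
- by move=> n; exact: normr_ge0.
- by move=> n; rewrite /= mulr_ge0 ?invr_ge0 ?(ltW m0)// exp_coeff_ge0.
- move=> n /=; rewrite /bessel_coeff /exp_coeff/= !normrM normrX.
  rewrite normrX normrN1 expr1n mul1r normfV normrM.
  have G0 : 0 < Gamma (n%:R + mu + 1) by exact: lt_le_trans (Gm n).
  rewrite ger0_norm// (ger0_norm (ltW G0)) /GRing.scale/= invfM.
  rewrite [_^-1 / _]mulrC -mulrA [_^-1 * `|y| ^+ n]mulrC.
  rewrite ler_wpM2r ?divr_ge0 ?exprn_ge0//.
  by rewrite lef_pV2 ?posrE.
- by apply: is_cvg_seriesZ; exact: is_cvg_series_exp_coeff.
Qed.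

Lemma pseries_diffs_bessel_coeff mu :
  pseries_diffs (bessel_coeff mu) = - bessel_coeff (mu + 1).
Proof.
apply/funext => k; rewrite /pseries_diffs /bessel_coeff fctE.
have -> : k.+1%:R + mu + 1 = k%:R + (mu + 1) + 1 :> R by rewrite -natr1; ring.
rewrite factS natrM exprS mulN1r !invfM mulNr mulrN; congr (- _).
by rewrite mulrCA -!mulrA mulVKf// pnatr_eq0.
Qed.

Lemma pseriesN (c : R^nat) y : pseries (- c) y = - pseries c y.
Proof.
apply/funext => n; change (pseries (- c) y n = - pseries c y n).
rewrite /pseries /series/= -sumrN.
by apply: eq_bigr => i _; rewrite mulNr.
Qed.

Lemma is_derive_Phi mu y : -1 < mu -> is_derive y 1 (Phi mu) (- Phi (mu + 1) y).
Proof.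
move=> mu1; pose K := `|y| + 1.
have mu2 : -1 < mu + 1 by lra.
have limN : limn (pseries (- bessel_coeff (mu + 1)) y) = - Phi (mu + 1) y.
  rewrite pseriesN limN//; exact: pseries_bessel_cvg.
have := @pseries_snd_diffs _ (bessel_coeff mu) K y.
rewrite !pseries_diffs_bessel_coeff pseries_diffsN pseries_diffs_bessel_coeff opprK.
rewrite limN; apply => //.
- exact: pseries_bessel_cvg.
- by rewrite pseriesN; apply: is_cvgN; exact: pseries_bessel_cvg.
- by apply: pseries_bessel_cvg; lra.
- by rewrite /K [ltRHS]ger0_norm ?ltrDl// addr_ge0.
Qed.

(** Coefficientwise [c_mu(k) = (k + mu + 1) c_(mu+1)(k)]; the factor [k] produces [y] times the
    derivative of [Phi (mu + 1)], which is [- Phi (mu + 2)]. *)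
Lemma Phi_recurrence mu y : -1 < mu ->
  y * Phi (mu + 2) y - (mu + 1) * Phi (mu + 1) y + Phi mu y = 0.
Proof.
move=> mu1.
have Gk (k : nat) : bessel_coeff mu k = (k%:R + mu + 1) * bessel_coeff (mu + 1) k.
  have kmu : 0 < k%:R + mu + 1 by rewrite -addrA ltr_wpDl//; lra.
  have G0 := Gamma_gt0 kmu.
  have f0 : (k`!%:R : R) != 0 by rewrite pnatr_eq0 -lt0n fact_gt0.
  rewrite /bessel_coeff addrA [Gamma (_ + mu + 1 + 1)]Gamma_rec//.
  by field; rewrite f0 !lt0r_neq0.
have mu2 : -1 < mu + 1 by lra.
pose s i := i%:R * bessel_coeff (mu + 1) i * y ^+ i.-1.
have h2 : cvgn (pseries (bessel_coeff (mu + 1 + 1)) y).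
  by apply: pseries_bessel_cvg; lra.
have hs : series s @ \oo --> - Phi (mu + 2) y.
  have := @pseries_diffs_equiv _ (bessel_coeff (mu + 1)) y.
  rewrite pseries_diffs_bessel_coeff pseriesN limN//.
  have -> : mu + 2 = mu + 1 + 1 by ring.
  move=> h; apply: h; exact: (cvgN h2).
have h1 : cvgn (pseries (bessel_coeff (mu + 1)) y).
  exact: pseries_bessel_cvg.
have h : pseries (bessel_coeff mu) y @ \oo -->
    (mu + 1) * Phi (mu + 1) y + y * (- Phi (mu + 2) y).
  have -> : pseries (bessel_coeff mu) y =
     (fun n => (mu + 1) * pseries (bessel_coeff (mu + 1)) y n + y * series s n).
    apply/funext => n; rewrite /pseries /series /= !mulr_sumr -big_split/=.
    apply: eq_bigr => -[|i] _; rewrite Gk /s/=; first by ring.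
    by rewrite exprS; ring.
  by apply: cvgD; apply: cvgM => //; exact: cvg_cst.
have {h} -> : Phi mu y = (mu + 1) * Phi (mu + 1) y + y * - Phi (mu + 2) y.
  by apply/cvg_lim: h.
by move: (Phi (mu + 1) y) (Phi (mu + 2) y) => a b; ring.
Qed.

Lemma besselJE mu x : -1 < mu ->
  besselJ mu x = (x / 2) `^ mu * Phi mu ((x / 2) ^+ 2).
Proof.
move=> mu1; apply/cvg_lim => //.
have -> : (fun n : nat => \sum_(0 <= k < n)
     ((-1) ^+ k / (k`!%:R * Gamma (k%:R + mu + 1)) * (x / 2) `^ mu *
      (x / 2) ^+ (2 * k))) =
  (fun n => (x / 2) `^ mu * pseries (bessel_coeff mu) ((x / 2) ^+ 2) n).
  apply/funext => n; rewrite /pseries /series/= mulr_sumr.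
  by apply: eq_bigr => i _; rewrite exprM /bessel_coeff mulrAC mulrC.
by apply: cvgM; [exact: cvg_cst | exact: pseries_bessel_cvg].
Qed.

Lemma Phi0 mu : Phi mu 0 = (Gamma (mu + 1))^-1.
Proof.
apply/cvg_lim => //; rewrite -cvg_shiftS.
rewrite (_ : (fun n => _) = cst (Gamma (mu + 1))^-1); first exact: cvg_cst.
apply/funext => n; rewrite /pseries /series /= big_nat_recl// big1_seq.
  by rewrite addr0 expr0 mulr1 /bessel_coeff expr0 fact0 !mul1r add0r.
by move=> i _; rewrite expr0n mulr0.
Qed.

End BesselSeries.

Global Opaque Phi.

(** * Decay and zeros of Bessel functions *)

Section BesselDecay.
Context {R : realType}.
Implicit Types mu x y z : R.

(* [J_mu x = (x/2)^mu * jb mu x] for [x > 0], with [jb mu] entire and even. *)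
Definition jb mu x : R := Phi mu ((x / 2) ^+ 2).
Definition jb' mu x : R := - (x / 2) * Phi (mu + 1) ((x / 2) ^+ 2).

Lemma is_derive_half_sqr x :
  is_derive x 1 (fun t : R => (t / 2) ^+ 2) (x / 2).
Proof.
have h : is_derive x 1 (fun t : R => t / 2) 2^-1.
  have := is_derive_scale 2^-1 (is_derive_id x (1:R)).
  by under eq_fun do rewrite mulrC; rewrite mulr1.
apply: (is_derive_eq (is_derive_mul h h)).
by field.
Qed.

Lemma is_derive_jb mu x : -1 < mu -> is_derive x 1 (jb mu) (jb' mu x).
Proof.
move=> mu1; apply: (is_derive_eq (is_derive_comp
  (g := fun t => (t / 2) ^+ 2) (is_derive_Phi _ mu1) (is_derive_half_sqr x))).
by rewrite /jb' mulNr mulrC mulNr.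
Qed.

(** This is Bessel's equation [jb'' = - (2 mu + 1) jb' / x - jb], written without division so that
    it also holds at [0]; the recurrence eliminates [Phi (mu + 2)]. *)
Lemma is_derive_jb' mu x : -1 < mu -> is_derive x 1 (jb' mu)
  ((mu + 2^-1) * Phi (mu + 1) ((x / 2) ^+ 2) - jb mu x).
Proof.
move=> mu1; have mu2 : -1 < mu + 1 by lra.
have h := is_derive_scale (- 2^-1) (is_derive_mul (is_derive_id x (1 : R))
  (is_derive_comp (g := fun t => (t / 2) ^+ 2)
    (is_derive_Phi _ mu2) (is_derive_half_sqr x))).
have -> : jb' mu = fun t => - 2^-1 * (t * Phi (mu + 1) ((t / 2) ^+ 2)).
  by apply/funext => t; rewrite /jb'; ring.
apply: (is_derive_eq h).
have := Phi_recurrence ((x / 2) ^+ 2) mu1.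
rewrite /jb (_ : mu + 2 = mu + 1 + 1); last by ring.
move: (Phi (mu + 1 + 1) _) (Phi (mu + 1) _) (Phi mu _) => a b c e.
have -> : c = (mu + 1) * b - (x / 2) ^+ 2 * a by lra.
by field.
Qed.

Lemma jb_continuous mu : -1 < mu -> continuous (jb mu).
Proof. by move=> mu1 x; apply: is_derive_continuous (is_derive_jb x mu1). Qed.

Lemma jb'_continuous mu : -1 < mu -> continuous (jb' mu).
Proof. by move=> mu1 x; apply: is_derive_continuous (is_derive_jb' x mu1). Qed.

(** For [u = x^(mu+1/2) * jb mu x], a multiple of [sqrt x * J_mu x], one has
    [u' = x^(mu+1/2) * Q mu x]. *)
Let Q mu x := jb' mu x + (mu + 2^-1) * (jb mu x / x).

Let is_derive_inv x : x != 0 -> is_derive x 1 (fun t : R => t^-1) (- x^-1 ^+ 2).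
Proof.
move=> x0; apply: (is_derive_eq (is_deriveV x0 (is_derive_id x (1:R)))).
by rewrite /GRing.scale/= mulr1 exprVn.
Qed.

Let is_derive_Q mu x : -1 < mu -> 0 < x -> is_derive x 1 (Q mu)
  (- jb mu x - (mu + 2^-1) * Q mu x / x + (mu ^+ 2 - 4^-1) * jb mu x / x ^+ 2).
Proof.
move=> mu1 x0; have xN0 := lt0r_neq0 x0.
apply: (is_derive_eq (is_derive_add (is_derive_jb' x mu1)
  (is_derive_scale (mu + 2^-1) (is_derive_mul (is_derive_jb x mu1)
    (is_derive_inv xN0))))).
rewrite /Q /jb'.
move: (Phi (mu + 1) _) (jb mu x) => a b.
by field.
Qed.

(* [x^(2 mu + 1) (Q^2 + jb^2)] is [u'^2 + u^2] for [u = sqrt x * J_mu x], up to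
   a constant; it varies little since [u'' = - (1 - (mu^2 - 1/4) / x^2) u]. *)
Let E mu x := x `^ (2 * mu + 1) * (Q mu x * Q mu x + jb mu x * jb mu x).

Let is_derive_E mu x : -1 < mu -> 0 < x -> is_derive x 1 (E mu)
  (2 * (mu ^+ 2 - 4^-1) * x `^ (2 * mu + 1) * Q mu x * jb mu x / x ^+ 2).
Proof.
move=> mu1 x0; have xN0 := lt0r_neq0 x0.
have dQ := is_derive_Q mu1 x0; have dj := is_derive_jb x mu1.
apply: (is_derive_eq (is_derive_mul (is_derive_powR (2 * mu + 1) x0)
  (is_derive_add (is_derive_mul dQ dQ) (is_derive_mul dj dj)))).
have -> : jb' mu x = Q mu x - (mu + 2^-1) * (jb mu x / x).
  by rewrite /Q addrK.
move: (x `^ _) (Q mu x) (jb mu x) => p q j.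
by field.
Qed.

(** A Gronwall argument: [2 |Q jb| <= Q^2 + jb^2] gives [|E'| <= |mu^2 - 1/4| E / x^2], so [E] times
    [exp (|mu^2 - 1/4| / x)] is nonincreasing. *)
Let E_bound mu x : -1 < mu -> 1 <= x ->
  E mu x <= E mu 1 * expR `|mu ^+ 2 - 4^-1|.
Proof.
move=> mu1 x1; set c := mu ^+ 2 - 4^-1.
have E0 t : 0 <= E mu t.
  by rewrite mulr_ge0 ?powR_ge0// addr_ge0// -expr2 sqr_ge0.
pose h (t : R) : R := expR (`|c| * t^-1).
have dh (t : R) : 0 < t -> is_derive t 1 h (h t * (`|c| * (- t^-1 ^+ 2))).
  move=> t0; apply: is_derive_comp.
  exact: (is_derive_scale `|c| (is_derive_inv (lt0r_neq0 t0))).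
have : E mu x * h x <= E mu 1 * h 1.
  apply: (derive_le0_nonincreasing (f := fun t => E mu t * h t) x1).
    move=> t /andP[t1 _]; have t0 : 0 < t by lra.
    exact: (is_derive_mul (is_derive_E mu1 t0) (dh t t0)).
  move=> t /andP[t1 _] /=; have t0 : 0 < t by lra.
  rewrite -/c.
  have -> : 2 * c * t `^ (2 * mu + 1) * Q mu t * jb mu t / t ^+ 2 * h t +
     E mu t * (h t * (`|c| * - t^-1 ^+ 2)) =
     (2 * (c * t `^ (2 * mu + 1) * Q mu t * jb mu t) - `|c| * E mu t) *
       (h t * t^-1 ^+ 2).
    by field; exact: lt0r_neq0.
  rewrite mulr_le0_ge0 ?mulr_ge0 ?expR_ge0 ?exprn_ge0 ?invr_ge0 ?(ltW t0)//.
  rewrite subr_le0 /E.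
  have p0 : 0 <= t `^ (2 * mu + 1) by exact: powR_ge0.
  move: (t `^ _) p0 (Q mu t) (jb mu t) => p p0 q j.
  have cj : c * p * (q * j) <= `|c| * p * `|q * j|.
    apply: (le_trans (ler_norm _)); rewrite normrM [`|c * p|]normrM.
    by rewrite (ger0_norm p0).
  have qj : 2 * `|q * j| <= q * q + j * j.
    have [h0|h0] := ger0P (q * j).
      by have := sqr_ge0 (q - j); nra.
    by have := sqr_ge0 (q + j); nra.
  have cp : 0 <= `|c| * p by rewrite mulr_ge0.
  have := ler_wpM2l cp qj.
  lra.
rewrite /h invr1 mulr1; apply: le_trans.
rewrite ler_peMr// -[leLHS]expR0 ler_expR mulr_ge0// invr_ge0; lra.
Qed.

(** For [x > 1] the bound on [E] controls [(x^(mu+1/2) jb)^2]; on [[0, 1]] continuity suffices. The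
    two are joined through [max 1 x >= (1 + x) / 2]. *)
Lemma jb_decay mu : - 2^-1 < mu -> exists2 C : R, 0 < C &
  forall x, 0 <= x -> `|jb mu x| <= C * (1 + x) `^ (- (mu + 2^-1)).
Proof.
move=> mu2; have mu1 : -1 < mu by lra.
have k0 : 0 <= mu + 2^-1 by lra.
pose M := E mu 1 * expR `|mu ^+ 2 - 4^-1|.
have M0 : 0 <= M.
  by rewrite !mulr_ge0 ?powR_ge0 ?expR_ge0// addr_ge0// -expr2 sqr_ge0.
have [c _ cm] : exists2 c, c \in `[0, 1] &
    forall t, t \in `[0, 1] -> `|jb mu t| <= `|jb mu c|.
  apply: (@EVT_max R (fun x => `|jb mu x|)); first exact: ler01.
  apply: continuous_subspaceT => x; apply: continuous_comp.
    exact: jb_continuous.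
  exact: norm_continuous.
pose C0 := `|jb mu c|; have C00 : 0 <= C0 by exact: normr_ge0.
have key x : 0 <= x ->
   `|jb mu x| <= (C0 + Num.sqrt M + 1) * (Num.max 1 x) `^ (- (mu + 2^-1)).
  move=> x0; have [x1|x1] := leP x 1.
    rewrite powR1 mulr1.
    have := cm x; rewrite in_itv/= x0 x1 => /(_ isT) h.
    by rewrite (le_trans h)// /C0 -addrA lerDl addr_ge0// sqrtr_ge0.
  have x00 : 0 < x by lra.
  have := E_bound mu1 (ltW x1); rewrite -/M => EM.
  have h : (jb mu x * x `^ (mu + 2^-1)) ^+ 2 <= M.
    apply: le_trans EM; rewrite /E exprMn mulrC.
    rewrite -powR_mulrn ?powR_ge0// -powRrM.
    have -> : (mu + 2^-1) * 2 = 2 * mu + 1 by field.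
    by rewrite ler_wpM2l ?powR_ge0// -!expr2 lerDr sqr_ge0.
  have h2 : `|jb mu x * x `^ (mu + 2^-1)| <= Num.sqrt M.
    by rewrite -sqrtr_sqr ler_wsqrtr.
  rewrite powRN ler_pdivlMr ?powR_gt0//.
  rewrite normrM (ger0_norm (powR_ge0 _ _)) in h2.
  rewrite (le_trans h2)//.
  by rewrite addrAC lerDr; apply: addr_ge0.
exists ((C0 + Num.sqrt M + 1) * 2 `^ (mu + 2^-1)).
  by rewrite mulr_gt0 ?powR_gt0// ltr_wpDl// addr_ge0// sqrtr_ge0.
move=> x x0; apply: (le_trans (key x x0)).
rewrite -mulrA ler_wpM2l ?addr_ge0 ?sqrtr_ge0//.
have m0 : 0 < Num.max 1 x by rewrite lt_max ltr01.
rewrite !powRN -[2 `^ _]invrK -invfM lef_pV2 ?posrE; last 2 first.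
- by rewrite powR_gt0.
- by rewrite mulr_gt0 ?invr_gt0 ?powR_gt0// ltr_pwDl.
rewrite mulrC ler_pdivrMr ?powR_gt0// -powRM ?(ltW m0)//.
have h1 : 1 <= Num.max 1 x by rewrite le_max lexx.
have h2 : x <= Num.max 1 x by rewrite le_max lexx orbT.
by apply: (ge0_ler_powR k0); rewrite ?nnegrE; lra.
Qed.

(** Sturm comparison of [u = x^(mu+1/2) jb] with [v = sin ((x - z) / 2)], which solves
    [v'' = - v / 4]. If [u] kept one sign, say positive, the Wronskian [W = u' v - u v'] would be
    nonincreasing, yet it is negative at [z] and positive at [z + 2 pi]. *)
Lemma jb_zero_exists mu : - 2^-1 < mu -> exists2 Z : R, 0 < Z &
  forall z, Z <= z -> exists2 x, z <= x <= z + 2 * pi & jb mu x = 0.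
Proof.
move=> mu2; have mu1 : -1 < mu by lra.
pose c := mu ^+ 2 - 4^-1.
(* Beyond this point [c / x^2 <= 1/2], so the coefficient in [u'' = - (1 - c / x^2) u] stays above
   [1/4]. *)
exists (2 + 2 * `|c|); first by rewrite ltr_wpDr// mulr_ge0.
move=> z zZ; have pi0 := pi_gt0 R.
have z1 : 2 <= z by rewrite (le_trans _ zZ)// lerDl mulr_ge0.
apply/not_exists2P => noz.
have {}noz x : z <= x <= z + 2 * pi -> jb mu x != 0.
  by move=> h; apply/eqP => e; have [] := noz x.
(* Multiplying by [e] fixes the sign: without a zero, [e * jb mu] is positive on the whole
   interval. *)
pose e := jb mu z.
have zz : z <= z <= z + 2 * pi by apply/andP; split; lra.
have e0 : e != 0 by exact: noz.
have pos x : z <= x <= z + 2 * pi -> 0 < e * jb mu x.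
  move=> zx; rewrite ltNge; apply/negP => le0.
  have /andP[zx1 zx2] := zx.
  have [|||y] := @IVT R (fun t => e * jb mu t) z x 0.
  - by [].
  - apply: continuous_subspaceT => t; apply: cvgM; first exact: cvg_cst.
    exact: jb_continuous.
  - rewrite ge_min le_max le0 orbT/= -/e -expr2 sqr_ge0//.
  - rewrite in_itv/= => /andP[zy yx] /eqP; rewrite mulf_eq0 (negPf e0)/=.
    by apply/negP/noz; rewrite zy (le_trans yx).
pose D x : R := x `^ (mu + 2^-1).
pose th x : R := 2^-1 * (x - z).
have dth x : is_derive x 1 th 2^-1.
  apply: (is_derive_eq (is_derive_scale 2^-1
    (is_derive_sub (is_derive_id x (1:R)) (is_derive_cst z x (1:R))))).
  by rewrite subr0 mulr1.
pose W x := D x * (e * (Q mu x * sin (th x) - 2^-1 * (jb mu x * cos (th x)))).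
have : W (z + 2 * pi) <= W z.
  apply: (derive_le0_nonincreasing (f' := fun x => D x * (e * jb mu x) *
     sin (th x) * (4^-1 - 1 + c / x ^+ 2))).
  - lra.
  - move=> x /andP[zx _]; have x0 : 0 < x by lra.
    have xN0 := lt0r_neq0 x0.
    have ds := is_derive_comp (is_derive_sin (th x)) (dth x).
    have dc := is_derive_comp (is_derive_cos (th x)) (dth x).
    apply: (is_derive_eq (is_derive_mul (is_derive_powR (mu + 2^-1) x0)
      (is_derive_scale e (is_derive_sub
        (is_derive_mul (is_derive_Q mu1 x0) ds)
        (is_derive_scale 2^-1 (is_derive_mul (is_derive_jb x mu1) dc)))))).
    rewrite -/(D x) -/c.
    have -> : jb' mu x = Q mu x - (mu + 2^-1) * (jb mu x / x).
      by rewrite /Q addrK.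
    move: (D x) (Q mu x) (jb mu x) (sin _) (cos _) => p q j s k.
    by field.
  - move=> x /andP[zx xz]; have x0 : 0 < x by lra.
    have jp := pos x; rewrite zx xz in jp.
    have sg : 0 <= sin (th x).
      by apply: sin_ge0_pi; rewrite /th; apply/andP; split; lra.
    rewrite mulr_ge0_le0 ?(mulr_ge0 (mulr_ge0 (powR_ge0 _ _) (ltW (jp isT))))//.
    have : c / x ^+ 2 <= 2^-1.
      rewrite ler_pdivrMr ?exprn_gt0//.
      have := ler_norm c; nra.
    lra.
have t1 : th z = 0 by rewrite /th subrr mulr0.
have t2 : th (z + 2 * pi) = pi by rewrite /th; field.
rewrite /W t1 t2 sin0 cos0 sinpi cospi.
have zz2 : z <= z + 2 * pi <= z + 2 * pi by apply/andP; split; lra.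
have h1 := pos _ zz; have h2 := pos _ zz2.
have D1 : 0 < D z by apply: powR_gt0; lra.
have D2 : 0 < D (z + 2 * pi) by apply: powR_gt0; lra.
have := mulr_gt0 D1 h1; have := mulr_gt0 D2 h2.
clearbody e; move: (D z) (D _) (jb mu z) (jb mu _) (Q mu z) (Q mu _) => a b u v q r.
lra.
Qed.

End BesselDecay.

(** * Fourier-Bessel series *)

Section WeightedIntegral.
Context {R : realType}.
Implicit Types (a x : R) (f g : R -> R).
Local Notation leb := (@lebesgue_measure R).

Lemma continuous_normr_powR a : 0 < a -> continuous (fun x : R => `|x| `^ a).
Proof.
move=> a0 x; have [->|x0] := eqVneq x 0; last first.
  have nx0 : 0 < `|x| by rewrite normr_gt0.
  apply: (@continuous_comp _ _ _ (fun x : R => `|x|) (fun t : R => t `^ a)).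
    exact: norm_continuous.
  exact: continuous_powR_gt0.
apply/cvgrPdist_le => /= e e0; near=> y.
rewrite normr0 powR0 ?lt0r_neq0// sub0r normrN ger0_norm ?powR_ge0//.
have -> : e = (e `^ a^-1) `^ a by rewrite -powRrM mulVf ?lt0r_neq0// powRr1// ltW.
rewrite ge0_ler_powR ?nnegrE ?powR_ge0 ?(ltW a0)//.
near: y.
have e1 : 0 < e `^ a^-1 by exact: powR_gt0.
by exists (e `^ a^-1) => //= y /=; rewrite sub0r normrN => /ltW.
Unshelve. all: by end_near. Qed.

Lemma Rintegral_oo_indic f (eta : R) : 0 < eta <= 1 ->
  \int[leb]_(x in `]0%R, 1%R[) (\1_(`]0%R, eta[ : set R) x * f x) =
  \int[leb]_(x in `]0%R, eta[) f x.
Proof.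
move=> /andP[eta0 eta1].
have -> : (`]0%R, eta[%classic : set R) = `]0%R, 1%R[ `&` `]0%R, eta[.
  apply/seteqP; split => x /=; rewrite !in_itv/=; last by case.
  by move=> /andP[-> xe]; rewrite xe (lt_le_trans xe).
rewrite Rintegral_mkcondr; apply: eq_Rintegral => x xi /=.
rewrite patchE indicE in_setI xi/=.
by case: ifPn => _; rewrite ?mul1r ?mul0r.
Qed.

Lemma integrable_indic_oo f (eta : R) : continuous f ->
  leb.-integrable `]0%R, 1%R[
    (EFin \o (fun x => \1_(`]0%R, eta[ : set R) x * f x)).
Proof.
move=> cf; have i := continuous_integrable_oo 0 1 cf.
apply: (le_integrable _ _ _ i) => //.
  apply/measurable_EFinP; apply: measurable_funM.
    exact: measurable_indic.
  apply: (measurable_funS measurableT) => //.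
  exact: continuous_measurable_fun.
move=> x _ /=; rewrite lee_fin normrM ler_piMl// indicE.
by case: (_ \in _); rewrite ?normr1 ?normr0.
Qed.

Lemma Rintegral_normr_powR a (eta : R) : 0 < a -> 0 < eta ->
  \int[leb]_(x in `]0%R, eta[) (`|x| `^ a) = eta `^ (a + 1) / (a + 1).
Proof.
move=> a0 eta0; have a10 : 0 < a + 1 by lra.
pose F (x : R) := (a + 1)^-1 * `|x| `^ (a + 1).
have -> : eta `^ (a + 1) / (a + 1) = F eta - F 0.
  by rewrite /F normr0 powR0 ?lt0r_neq0// mulr0 subr0 gtr0_norm// mulrC.
apply: continuous_FTC2_oo => //.
- by move=> x _; exact: continuous_normr_powR.
- move=> x _; apply: cvgM; first exact: cvg_cst.
  exact: continuous_normr_powR.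
- move=> x /andP[x0 _].
  have h := is_derive_scale (a + 1)^-1 (is_derive_powR (a + 1) x0).
  apply: (@near_eq_is_derive _ _ _ (fun x => (a + 1)^-1 * x `^ (a + 1))) => //.
  near=> y; rewrite /F gtr0_norm//.
  by near: y; exact: lt_nbhsr.
  apply: (is_derive_eq h).
  rewrite gtr0_norm// powRD ?(lt0r_neq0 x0) ?implybT// powRr1 ?ltW//.
  by field; rewrite !lt0r_neq0.
Unshelve. all: by end_near. Qed.

End WeightedIntegral.

(** * Orthogonality and the action of the Bochner-Riesz multiplier *)

Section FourierBessel.
Context {R : realType}.
Variables (nu : R) (s : nat -> R).
Hypothesis nu_gt : - (1 / 2) < nu.
Hypothesis sP : bessel_zeros nu s.
Local Notation leb := (@lebesgue_measure R).
Local Notation Int f := (\int[leb]_(x in `]0%R, 1%R[) (f : R -> R) x).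

Implicit Types a b x : R.

Let nu1 : -1 < nu. Proof. by have := nu_gt; lra. Qed.
Let k0 : 0 < 2 * nu + 1. Proof. by have := nu_gt; lra. Qed.

(* Continuous on the whole line, unlike [wgt nu], which is [1] on the negative
   half-line. *)
Definition cwgt (x : R) : R := `|x| `^ (2 * nu + 1).

Lemma cwgt_continuous : continuous cwgt.
Proof. exact: continuous_normr_powR. Qed.

Lemma cwgt_ge0 x : 0 <= cwgt x. Proof. exact: powR_ge0. Qed.

Lemma cwgtE x : 0 < x -> cwgt x = wgt nu x.
Proof. by move=> x0; rewrite /cwgt gtr0_norm. Qed.

Lemma cwgt0 : cwgt 0 = 0.
Proof. by rewrite /cwgt normr0 powR0 ?lt0r_neq0. Qed.

Lemma cwgt1 : cwgt 1 = 1.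
Proof. by rewrite /cwgt normr1 powR1. Qed.

Lemma is_derive_cwgt x : 0 < x ->
  is_derive x 1 cwgt ((2 * nu + 1) * cwgt x / x).
Proof.
move=> x0; rewrite cwgtE// /wgt.
apply: (@near_eq_is_derive _ _ _ (fun x => x `^ (2 * nu + 1))) => //.
  near=> y; rewrite /cwgt gtr0_norm//.
  by near: y; exact: lt_nbhsr.
exact: is_derive_powR.
Unshelve. all: by end_near. Qed.

Let jbM_continuous a : continuous (fun x : R => jb nu (a * x)).
Proof.
move=> x; apply: (@continuous_comp _ _ _ (fun x : R => a * x) (jb nu)).
  by apply: cvgM; [exact: cvg_cst | exact: cvg_id].
exact: jb_continuous.
Qed.

Let jb'M_continuous a : continuous (fun x : R => jb' nu (a * x)).
Proof.
move=> x; apply: (@continuous_comp _ _ _ (fun x : R => a * x) (jb' nu)).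
  by apply: cvgM; [exact: cvg_cst | exact: cvg_id].
exact: jb'_continuous.
Qed.

Let dM a x : is_derive x 1 (fun x : R => a * x) a.
Proof.
apply: (is_derive_eq (is_derive_scale a (is_derive_id x (1:R)))).
by rewrite mulr1.
Qed.

Let d1 a x := is_derive_comp (g := fun x : R => a * x) (is_derive_jb (a * x) nu1)
  (dM a x).
Let d2 a x := is_derive_comp (g := fun x : R => a * x) (is_derive_jb' (a * x) nu1)
  (dM a x).

Let prod_continuous a b : continuous (fun x : R => jb nu (a * x) * jb nu (b * x) * cwgt x).
Proof.
move=> x; apply: cvgM; last exact: cwgt_continuous.
by apply: cvgM; exact: jbM_continuous.
Qed.

(** Green's identity: by Bessel's equation, [b^2 - a^2] times the integrand is the derivative of the
    weighted Wronskian [F], which vanishes at [1] because [a] and [b] are zeros and at [0] because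
    of the weight. *)
Lemma Lommel_integral a b : jb nu a = 0 -> jb nu b = 0 -> a ^+ 2 != b ^+ 2 ->
  Int (fun x => jb nu (a * x) * jb nu (b * x) * cwgt x) = 0.
Proof.
move=> ja jb0 ab.
have i := continuous_integrable_oo 0 1 (@prod_continuous a b).
have : (b ^+ 2 - a ^+ 2) * Int (fun x => jb nu (a * x) * jb nu (b * x) * cwgt x) = 0.
  rewrite -RintegralZl//.
  pose F x := cwgt x * (a * (jb' nu (a * x) * jb nu (b * x)) -
                        b * (jb nu (a * x) * jb' nu (b * x))).
  have F01 : F 1 - F 0 = 0.
    by rewrite /F !mulr1 cwgt0 ja jb0 !mulr0 !mul0r !mulr0 subrr mulr0 subr0.
  rewrite -[RHS]F01.
  apply: continuous_FTC2_oo => //.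
  - move=> x _; apply: cvgM; [exact: cvg_cst | exact: prod_continuous].
  - move=> x _; apply: cvgM; first exact: cwgt_continuous.
    apply: cvgB; apply: cvgM; try exact: cvg_cst; apply: cvgM;
      solve [exact: jbM_continuous | exact: jb'M_continuous].
  - move=> x /andP[x0 _].
    apply: (is_derive_eq (is_derive_mul (is_derive_cwgt x0) (is_derive_sub
       (is_derive_scale a (is_derive_mul (d2 a x) (d1 b x)))
       (is_derive_scale b (is_derive_mul (d1 a x) (d2 b x)))))).
    rewrite /jb'; have xN0 := lt0r_neq0 x0.
    move: (cwgt x) (jb nu (a * x)) (jb nu (b * x)) (Phi _ _) (Phi _ _) => w p q u v.
    by field.
move/eqP; rewrite mulf_eq0 subr_eq0 eq_sym (negPf ab)/= => /eqP.
exact.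
Qed.

(** [F] is an antiderivative of [2 a^2] times the integrand; at [1] only [a^2 jb'(a)^2] survives,
    and at [0] the weight kills everything. *)
Lemma Lommel_integral_sqr a : a != 0 -> jb nu a = 0 ->
  Int (fun x => jb nu (a * x) * jb nu (a * x) * cwgt x) = jb' nu a ^+ 2 / 2.
Proof.
move=> a0 ja.
have i := continuous_integrable_oo 0 1 (@prod_continuous a a).
have : 2 * a ^+ 2 * Int (fun x => jb nu (a * x) * jb nu (a * x) * cwgt x) =
    a ^+ 2 * jb' nu a ^+ 2.
  rewrite -RintegralZl//.
  pose F x := a ^+ 2 * (x * cwgt x * (jb' nu (a * x) * jb' nu (a * x) +
     jb nu (a * x) * jb nu (a * x))) +
     2 * nu * a * (cwgt x * (jb nu (a * x) * jb' nu (a * x))).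
  have -> : a ^+ 2 * jb' nu a ^+ 2 = F 1 - F 0.
    rewrite /F !mulr1 cwgt0 cwgt1 ja; ring.
  apply: continuous_FTC2_oo => //.
  - move=> x _; apply: cvgM; [exact: cvg_cst | exact: prod_continuous].
  - move=> x _; apply: continuous_addf; apply: continuous_scalef;
      apply: continuous_mulf => //.
    + apply: continuous_mulf; last exact: cwgt_continuous.
      by move=> y; exact: cvg_id.
    + by apply: continuous_addf; apply: continuous_mulf.
    + exact: cwgt_continuous.
    + exact: continuous_mulf.
  - move=> x /andP[x0 _].
    apply: (is_derive_eq (is_derive_add (is_derive_scale (a ^+ 2)
      (is_derive_mul (is_derive_mul (is_derive_id x (1:R)) (is_derive_cwgt x0))
       (is_derive_add (is_derive_mul (d2 a x) (d2 a x))
         (is_derive_mul (d1 a x) (d1 a x)))))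
       (is_derive_scale (2 * nu * a) (is_derive_mul (is_derive_cwgt x0)
         (is_derive_mul (d1 a x) (d2 a x)))))).
    rewrite /jb'; have xN0 := lt0r_neq0 x0.
    move: (cwgt x) (jb nu (a * x)) (Phi _ _) => w p u.
    by field.
have a20 : a ^+ 2 != 0 by rewrite sqrf_eq0.
move=> h; apply: (mulfI a20); rewrite mulrA -h; by field.
Qed.

Lemma jb0_gt0 : 0 < jb nu 0.
Proof.
rewrite /jb mul0r expr0n Phi0 invr_gt0 Gamma_gt0//.
by have := nu1; lra.
Qed.

Lemma jb_lower_bound : exists2 c : R, 0 < c <= 1 &
  forall z, 0 <= z <= c -> jb nu 0 / 2 <= jb nu z.
Proof.
have j2 : 0 < jb nu 0 / 2 by rewrite divr_gt0// jb0_gt0.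
have /cvgrPdist_lt/(_ _ j2)[e /= e0 he] := @jb_continuous _ nu nu1 0.
exists (Num.min (e / 2) 1).
  by rewrite lt_min divr_gt0//= ltr01 ge_min lexx orbT.
move=> z /andP[z0]; rewrite le_min => /andP[ze _].
have : `|jb nu 0 - jb nu z| < jb nu 0 / 2.
  by apply: he => /=; rewrite sub0r normrN ger0_norm//; lra.
by move=> /(le_lt_trans (ler_norm _)); lra.
Qed.

(** The [mu_nu]-measure of [(0, eta)]. *)
Definition mass eta : R := eta `^ (2 * nu + 2) / (2 * nu + 2).

Lemma Rintegral_indic_cwgt eta : 0 < eta <= 1 ->
  Int (fun x : R => \1_(`]0%R, eta[ : set R) x * cwgt x) = mass eta.
Proof.
move=> eta01; have /andP[eta0 _] := eta01.
rewrite Rintegral_oo_indic// /cwgt Rintegral_normr_powR//.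
by rewrite /mass (_ : 2 * nu + 1 + 1 = 2 * nu + 2)//; ring.
Qed.

Lemma mass_gt0 eta : 0 < eta -> 0 < mass eta.
Proof. by move=> e0; rewrite divr_gt0 ?powR_gt0//; have := nu1; lra. Qed.

(** For a frequency [a <= c / eta] the argument [a x] stays in [[0, c]]. Taking [eta] of order
    [1 / Rr] thus treats all frequencies up to [Rr] with one lower bound. *)
Lemma Rintegral_indic_jb_ge c eta a :
  (forall z, 0 <= z <= c -> jb nu 0 / 2 <= jb nu z) ->
  0 <= a -> a * eta <= c -> 0 < eta <= 1 ->
  jb nu 0 / 2 * mass eta <=
  Int (fun x : R => \1_(`]0%R, eta[ : set R) x * (jb nu (a * x) * cwgt x)).
Proof.
move=> hc a0 aeta eta01; have /andP[eta0 _] := eta01.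
have cj : continuous (fun x : R => jb nu (a * x) * cwgt x).
  by apply: continuous_mulf; [exact: jbM_continuous|exact: cwgt_continuous].
rewrite -Rintegral_indic_cwgt// -RintegralZl//; last first.
  by apply: integrable_indic_oo; exact: cwgt_continuous.
apply: le_Rintegral => //.
- have := @integrable_indic_oo _ _ eta
    (continuous_scalef (c := jb nu 0 / 2) cwgt_continuous).
  rewrite (_ : (fun x : R => _) = fun x : R =>
    jb nu 0 / 2 * (\1_(`]0%R, eta[ : set R) x * cwgt x)); first exact.
  by apply/funext => x; rewrite mulrCA.
- exact: integrable_indic_oo.
move=> x; rewrite /= in_itv/= => /andP[x0 x1].
rewrite mulrCA indicE; case: (boolP (x \in _)); rewrite ?mul0r// !mul1r.
rewrite inE/= in_itv/= => /andP[_ xe].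
rewrite ler_wpM2r ?cwgt_ge0// hc// mulr_ge0 ?(ltW x0)//=.
by apply: le_trans aeta; rewrite ler_wpM2l// ltW.
Qed.

Lemma jb_zero j : jb nu (s j) = 0.
Proof.
have [s0 sz _ _] := sP; have := sz j; rewrite besselJE// => /eqP.
by rewrite mulf_eq0 gt_eqF ?powR_gt0 ?divr_gt0//= => /eqP.
Qed.

(** By [Lommel_integral_sqr] a vanishing derivative would make the weighted norm of
    [jb nu (s j * x)] zero, whereas this function stays above [jb nu 0 / 2] near [0]. *)
Lemma jb'_zero_neq0 j : jb' nu (s j) != 0.
Proof.
have [s0 _ _ _] := sP; have sj := s0 j.
have [c /andP[c0 c1] hc] := jb_lower_bound.
pose eta := Num.min 1 (c / s j).
have eta01 : 0 < eta <= 1 by rewrite lt_min ltr01 divr_gt0//= ge_min lexx.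
have /andP[eta0 _] := eta01.
have seta : s j * eta <= c.
  have : eta <= c / s j by rewrite ge_min lexx orbT.
  by rewrite ler_pdivlMr// mulrC.
suff : 0 < jb' nu (s j) ^+ 2 / 2.
  by apply: contraTneq => ->; rewrite expr0n/= mul0r ltxx.
rewrite -(Lommel_integral_sqr (lt0r_neq0 sj) (jb_zero j)).
have h := Rintegral_indic_jb_ge hc (ltW sj) seta eta01.
have j0 := jb0_gt0.
have cj : continuous (fun x : R => jb nu (s j * x) * cwgt x).
  by apply: continuous_mulf; [exact: jbM_continuous|exact: cwgt_continuous].
have cjj := @prod_continuous (s j) (s j).
apply: (@lt_le_trans _ _ (jb nu 0 / 2 * (jb nu 0 / 2 * mass eta))).
  have m0 := mass_gt0 eta0.
  by apply: mulr_gt0; [lra|apply: mulr_gt0; [lra|exact: m0]].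
have j2 : 0 <= jb nu 0 / 2 by lra.
apply: (le_trans (ler_wpM2l j2 h)).
rewrite -RintegralZl//; last exact: integrable_indic_oo.
apply: le_Rintegral => //.
- have := @integrable_indic_oo _ _ eta
    (continuous_scalef (c := jb nu 0 / 2) cj).
  rewrite (_ : (fun x : R => _) = fun x : R =>
    jb nu 0 / 2 * (\1_(`]0%R, eta[ : set R) x * (jb nu (s j * x) * cwgt x))).
    exact.
  by apply/funext => x; rewrite mulrCA.
- exact: continuous_integrable_oo.
move=> x; rewrite /= in_itv/= => /andP[x0 x1].
have sq : 0 <= jb nu (s j * x) * jb nu (s j * x) * cwgt x.
  by rewrite mulr_ge0 ?cwgt_ge0// -expr2 sqr_ge0.
rewrite indicE; case: (boolP (x \in _)); rewrite ?mul0r ?mulr0// !mul1r.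
rewrite inE/= in_itv/= => /andP[_ xe].
have hx : jb nu 0 / 2 <= jb nu (s j * x).
  apply: hc; rewrite mulr_ge0 ?(ltW x0) ?(ltW sj)//=.
  by apply: le_trans seta; rewrite ler_wpM2l// ltW.
rewrite mulrA ler_wpM2r ?cwgt_ge0// ler_wpM2r//.
by apply: le_trans hx; rewrite ltW// divr_gt0.
Qed.

Let kap j : R := Num.sqrt 2 / `|jb' nu (s j)|.

(** Since [J_(nu+1)(s_j) = - (s_j/2)^nu * jb'(s_j)], the powers of [s_j / 2] and of [x] cancel. *)
Lemma psiE j x : 0 < x -> psi nu s j x = kap j * jb nu (s j * x).
Proof.
move=> x0; have [s0 _ _ _] := sP; have sj := s0 j.
have h0 : 0 < s j / 2 by rewrite divr_gt0.
have p0 : 0 < (s j / 2) `^ nu by exact: powR_gt0.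
rewrite /psi !besselJE//; last by have := nu1; lra.
have -> : (s j / 2) `^ (nu + 1) * Phi (nu + 1) ((s j / 2) ^+ 2) =
    - ((s j / 2) `^ nu * jb' nu (s j)).
  rewrite powRD ?(lt0r_neq0 h0) ?implybT// powRr1 ?(ltW h0)// /jb'.
  by move: (Phi _ _) => u; ring.
rewrite normrN normrM (gtr0_norm p0).
have -> : s j * x / 2 = s j / 2 * x by rewrite mulrAC.
rewrite (powRM nu (ltW h0) (ltW x0)) powRN /kap /jb.
have -> : s j / 2 * x = s j * x / 2 by rewrite mulrAC.
have n0 : `|jb' nu (s j)| != 0 by rewrite normr_eq0 jb'_zero_neq0.
have xn : x `^ nu != 0 by rewrite lt0r_neq0// powR_gt0.
move: (Phi _ _) (`|jb' nu (s j)|) n0 (x `^ nu) xn (Num.sqrt 2) => u v v0 w w0 q.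
by field; rewrite v0 w0 lt0r_neq0.
Qed.

Lemma coefE j (f : R -> R) :
  leb.-integrable `]0%R, 1%R[
    (EFin \o (fun x => f x * (jb nu (s j * x) * cwgt x))) ->
  coef nu s j f = kap j * Int (fun x : R => f x * (jb nu (s j * x) * cwgt x)).
Proof.
move=> i; rewrite -RintegralZl// /coef /Rintegral; congr fine.
apply: eq_integral => x; rewrite inE/= in_itv/= => /andP[x0 _].
by rewrite psiE// cwgtE//; congr EFin; ring.
Qed.

Lemma coefZ j (k : R) (f : R -> R) :
  leb.-integrable `]0%R, 1%R[
    (EFin \o (fun x => f x * (jb nu (s j * x) * cwgt x))) ->
  coef nu s j (fun x => k * f x) = k * coef nu s j f.
Proof.
move=> i.
have e : (fun x => k * f x * (jb nu (s j * x) * cwgt x)) =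
    (fun x => k * (f x * (jb nu (s j * x) * cwgt x))).
  by apply/funext => x; rewrite -mulrA.
rewrite !coefE//; last first.
  by rewrite e; exact: (@integrableZl _ _ _ leb _ _ k (EFin \o _)).
by rewrite [X in Rintegral _ _ X]e RintegralZl// mulrCA.
Qed.

(** The multiplier vanishes from index [n] on, so the series is a finite sum, which defines [B] on
    the whole line. The factor [k] serves the endpoint case, where the input must be normalized in
    [L^1]. *)
Lemma bochner_riesz_pairing delta Rr (f : R -> R) : delta != 0 -> 0 < Rr ->
  (exists n, Rr <= s n) ->
  (forall a, leb.-integrable `]0%R, 1%R[
    (EFin \o (fun x => f x * (jb nu (a * x) * cwgt x)))) ->
  exists B : R -> R, [/\ continuous B,
    forall k x, 0 < x ->
      bochner_riesz nu s delta Rr (fun y => k * f y) x = k * B x &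
    forall l, Int (fun x : R => B x * (jb nu (s l * x) * cwgt x)) =
      Num.max (1 - s l ^+ 2 / Rr ^+ 2) 0 `^ delta *
      Int (fun x : R => f x * (jb nu (s l * x) * cwgt x))].
Proof.
move=> d0 Rr0 [n Rn] fi; have [s0 _ smono _] := sP.
pose m j : R := Num.max (1 - s j ^+ 2 / Rr ^+ 2) 0 `^ delta.
(* Here [delta != 0] matters: the power convention gives [0^0 = 1]. *)
have m0 j : (n <= j)%N -> m j = 0.
  move=> nj; have Rj : Rr <= s j.
    apply: (le_trans Rn); move: nj; rewrite leq_eqVlt => /predU1P[->//|].
    by move=> /smono/ltW.
  rewrite /m max_r ?powR0// subr_le0 ler_pdivlMr ?exprn_gt0// mul1r.
  by rewrite lerXn2r ?nnegrE ?(ltW Rr0)// ltW.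
pose b j := m j * coef nu s j f * kap j.
pose B x := \sum_(0 <= j < n) b j * jb nu (s j * x).
exists B; split.
- by apply: continuous_sumf => j; apply: continuous_scalef; exact: jbM_continuous.
- move=> k x x0; apply: lim_near_cst => //.
  near=> N; rewrite (big_cat_nat (n := n))//=; last by near: N; exists n.
  rewrite [X in _ + X]big_nat_cond [X in _ + X]big1 ?addr0; last first.
    by move=> j; rewrite andbT => /andP[nj _]; rewrite -/(m j) m0// !mul0r.
  rewrite mulr_sumr; apply: eq_bigr => j _.
  by rewrite -/(m j) psiE// coefZ// /b !mulrA [m j * k]mulrC.
- move=> l.
  have -> : Int (fun x : R => B x * (jb nu (s l * x) * cwgt x)) =
      \sum_(0 <= j < n) b j *
        Int (fun x : R => jb nu (s j * x) * jb nu (s l * x) * cwgt x).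
    rewrite (eq_Rintegral leb (g := fun x => \sum_(0 <= j < n)
       b j * (jb nu (s j * x) * jb nu (s l * x) * cwgt x))); last first.
      by move=> x _; rewrite /B mulr_suml; apply: eq_bigr => j _; rewrite !mulrA.
    rewrite Rintegral_sum_oo; last first.
      by move=> j; apply: continuous_scalef; exact: prod_continuous.
    apply: eq_bigr => j _; rewrite RintegralZl//.
    by apply: continuous_integrable_oo; exact: prod_continuous.
  have orth j : j != l ->
      Int (fun x : R => jb nu (s j * x) * jb nu (s l * x) * cwgt x) = 0.
    move=> jl; apply: Lommel_integral; rewrite ?jb_zero//.
    rewrite eqrXn2 ?(ltW (s0 _))//.
    have [h|h|h] := ltngtP j l; first by rewrite lt_eqF// smono.
      by rewrite gt_eqF// smono.
    by rewrite h eqxx in jl.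
  (* For [l >= n] both sides vanish; for [l < n] orthogonality keeps the term [j = l], where [kap^2]
     cancels the squared norm. *)
  have [ln|nl] := ltnP l n; last first.
    rewrite -/(m l) m0// mul0r big_nat_cond big1// => j.
    rewrite andbT => /andP[_ jn]; rewrite orth ?mulr0//.
    by rewrite neq_ltn (leq_trans jn nl).
  rewrite (bigD1_seq l) ?mem_index_iota ?iota_uniq//=.
  rewrite big1 ?addr0; last by move=> j jl; rewrite orth ?mulr0.
  rewrite Lommel_integral_sqr ?jb_zero ?lt0r_neq0// /b coefE// -/(m l).
  have n0 : jb' nu (s l) != 0 by exact: jb'_zero_neq0.
  have -> : jb' nu (s l) ^+ 2 = `|jb' nu (s l)| ^+ 2 by rewrite real_normK// num_real.
  have n1 : `|jb' nu (s l)| != 0 by rewrite normr_eq0.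
  have q2 : Num.sqrt 2 * Num.sqrt 2 = 2 :> R by rewrite -expr2 sqr_sqrtr.
  set I := Rintegral _ _ _.
  rewrite /kap; move: (m l) (`|_|) n1 (Num.sqrt 2) q2 I => u v v0 q q2 I.
  have -> : u * (q / v * I) * (q / v) * (v ^+ 2 / 2) = u * (q * q * I) / 2.
    by field.
  by rewrite q2; field.
Unshelve. all: by end_near. Qed.

End FourierBessel.

(** * Extrapolation and dyadic sums *)

Section Extrapolation.
Context {R : realType}.
Implicit Types (mu x y t M : R) (m : nat).

Lemma poly_antideriv (q : {poly R}) (y c : R) : exists p : {poly R},
  [/\ (size p <= (size q).+1)%N, p^`() = q & p.[y] = c].
Proof.
pose p0 : {poly R} := \poly_(i < (size q).+1) (q`_i.-1 / i%:R).
have dp0 : p0^`() = q.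
  apply/polyP => i; rewrite coef_deriv coef_poly ltnS.
  case: ltnP => [_|h]; last by rewrite mul0rn nth_default.
  by rewrite -[LHS]mulr_natr divfK// pnatr_eq0.
exists (p0 + (c - p0.[y])%:P); split.
- rewrite (leq_trans (size_polyD _ _))// geq_max size_poly/=.
  by rewrite (leq_trans (size_polyC_leq1 _)).
- by rewrite derivD derivC addr0.
- by rewrite hornerD hornerC addrC subrK.
Qed.

(** [p] is the Taylor polynomial at [y0], built by integrating the one for [Phi (mu + 1) = - Phi'].
    One [p] serves every [y], as extrapolation from several nodes requires; the factor [1/m!] is
    given up. *)
Lemma Phi_taylor m mu y0 : -1 < mu -> exists2 p : {poly R}, (size p <= m)%N &
  forall y M, (forall t, Num.min y0 y <= t <= Num.max y0 y ->
      `|Phi (mu + m%:R) t| <= M) ->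
    `|Phi mu y - p.[y]| <= M * `|y - y0| ^+ m.
Proof.
elim: m mu => [|m IH] mu mu1.
  exists 0; first by rewrite size_poly0.
  move=> y M hM; rewrite horner0 subr0 expr0 mulr1.
  have := hM y; rewrite addr0; apply.
  by rewrite ge_min le_max !lexx !orbT.
have mu2 : -1 < mu + 1 by lra.
have [q sq hq] := IH _ mu2.
have [p [sp dp py]] := poly_antideriv (- q) y0 (Phi mu y0).
exists p; first by rewrite (leq_trans sp)// size_polyN.
move=> y M hM.
pose h t := Phi mu t - p.[t].
have dh t : is_derive t 1 h (- Phi (mu + 1) t + q.[t]).
  apply: (is_derive_eq (is_derive_sub (is_derive_Phi t mu1)
    (is_derive_poly p t))).
  by rewrite dp hornerN opprK.
have : `|h y - h y0| <= (M * `|y - y0| ^+ m) * `|y - y0|.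
  apply: (derive_bound (f' := fun t => - Phi (mu + 1) t + q.[t])).
  move=> t /andP[t1 t2]; rewrite addrC -normrN opprB.
  have M0 : 0 <= M.
    apply: le_trans (hM y0 _); first exact: normr_ge0.
    by rewrite ge_min le_max !lexx.
  have tt : `|t - y0| <= `|y - y0|.
    move: t1 t2; case: (leP y0 y) => yy t1 t2.
      by rewrite !ger0_norm; lra.
    by rewrite !ler0_norm; lra.
  apply: (@le_trans _ _ (M * `|t - y0| ^+ m)).
    apply: hq => u /andP[u1 u2].
    have -> : mu + 1 + m%:R = mu + m.+1%:R by rewrite -natr1; ring.
    apply: hM; move: t1 t2 u1 u2; case: (leP y0 y); case: (leP y0 t) => h1 h2 *;
      apply/andP; split; lra.
  by rewrite ler_wpM2l// lerXn2r ?nnegrE.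
by rewrite /h py subrr subr0 exprSr mulrA.
Qed.

(** The value at [a] of the Lagrange basis polynomial of the node [b i]. *)
Definition extrap_weight m (a : R) (b : nat -> R) (i : 'I_m) : R :=
  \prod_(j < m | j != i) ((a - b j) / (b i - b j)).

Lemma extrap_poly m a (b : nat -> R) (p : {poly R}) : (0 < m)%N -> injective b ->
  (size p <= m)%N -> p.[a] = \sum_(i < m) extrap_weight a b i * p.[b i].
Proof.
move=> m0 binj sp; rewrite {1}(lagrange_gen m0 binj sp).
rewrite horner_sum; apply: eq_bigr => i _.
rewrite hornerM hornerC (lagrangeE m0 binj) hornerM hornerC !horner_prod mulrC.
congr (_ * _); rewrite /extrap_weight prodf_div mulrC; congr (_ / _).
  by apply: eq_bigr => j _; rewrite hornerXsubC.
by apply: eq_bigr => j _; rewrite hornerXsubC.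
Qed.

(** Used with [c = x^2 / 4]: it makes the weights for the nodes [s_i^2 x^2 / 4] independent of
    [x]. *)
Lemma extrap_scale m a (b : nat -> R) c (i : 'I_m) : c != 0 -> injective b ->
  extrap_weight (a * c) (fun j => b j * c) i = extrap_weight a b i.
Proof.
move=> c0 binj; apply: eq_bigr => j ji; rewrite -!mulrBl invfM.
by rewrite mulrACA mulfV// mulr1.
Qed.

Lemma extrap_bound m a (b : nat -> R) K (i : 'I_m) : 1 <= K ->
  (forall j : nat, (j < m)%N -> j != i -> `|a - b j| <= K * `|b i - b j|) ->
  `|extrap_weight a b i| <= K ^+ m.
Proof.
move=> K1 h; have K0 : 0 <= K by lra.
rewrite normr_prod (@le_trans _ _ (\prod_(j < m | j != i) K))//.
  apply: ler_prod => j ji; rewrite normr_ge0/= normrM normfV.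
  have [->|bb] := eqVneq (b i) (b j).
    by rewrite subrr normr0 invr0 mulr0.
  by rewrite ler_pdivrMr ?normr_gt0 ?subr_eq0// h.
rewrite prodr_const ler_weXn2l//.
by rewrite (leq_trans (max_card _))// card_ord.
Qed.

End Extrapolation.

Section DyadicSum.
Context {R : realType}.
Implicit Types (t x delta : R).

(* The map [v/(1+v)] with [v = t^eta] telescopes along dyadic scales. *)
Lemma dyadic_sum (delta : R) (m : nat) : 0 < delta < m%:R ->
  exists2 C : R, 0 < C & forall x (k0 k1 : nat), 0 < x ->
  \sum_(k0 <= k < k1) (2 ^+ k) `^ (- delta) * Num.min 1 ((2 ^+ k * x) ^+ m)
    <= C * x `^ delta.
Proof.
move=> /andP[d0 dm].
(* With [t = 2^k x], the summand divided by [x^delta] is at most [min (t^eta) (t^-eta)]: the growth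
   [t^(m - delta)] and the decay [t^-delta] are both replaced by the slower rate. *)
pose eta := Num.min delta (m%:R - delta).
have eta0 : 0 < eta by rewrite lt_min d0 subr_gt0.
pose q : R := 2 `^ eta.
have q1 : 1 < q.
  by rewrite /q /powR pnatr_eq0/= expR_gt1 mulr_gt0// ln_gt0// ltr1n.
pose f t : R := t `^ eta / (1 + t `^ eta).
have f0 t : 0 <= f t by rewrite divr_ge0 ?addr_ge0 ?powR_ge0.
have f1 t : f t <= 1.
  have := powR_ge0 t eta; rewrite /f; move: (_ `^ _) => v v0.
  by rewrite ler_pdivrMr; lra.
have step t : 0 < t ->
   t `^ (- delta) * Num.min 1 (t ^+ m) <= 4 * q / (q - 1) * (f (2 * t) - f t).
  move=> t0.
  have h : t `^ (- delta) * Num.min 1 (t ^+ m) <= Num.min (t `^ eta) (t `^ (- eta)).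
    have [t1|t1] := leP t 1.
      apply: (@le_trans _ _ (t `^ eta)).
        apply: (@le_trans _ _ (t `^ (- delta) * t ^+ m)).
          by rewrite ler_wpM2l ?powR_ge0// ge_min lexx orbT.
        rewrite -powR_mulrn ?(ltW t0)// -powRD ?(lt0r_neq0 t0) ?implybT//.
        apply: ger_powR; first by rewrite t0 t1.
        by rewrite ge_min addrC lexx orbT.
      rewrite le_min lexx/=; apply: ger_powR; first by rewrite t0 t1.
      by have := eta0; lra.
    apply: (@le_trans _ _ (t `^ (- eta))).
      apply: (@le_trans _ _ (t `^ (- delta))).
        by rewrite ler_piMr ?powR_ge0// ge_min lexx.
      by apply: ler_powR; [exact: ltW|rewrite lerN2 ge_min lexx].
    rewrite le_min lexx andbT; apply: ler_powR; first exact: ltW.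
    by have := eta0; lra.
  apply: (le_trans h); rewrite /f powRM ?(ltW t0)// -/q powRN.
  have v0 : 0 < t `^ eta by exact: powR_gt0.
  move: (t `^ eta) v0 => v v0.
  (* The increment of [f] is [(q - 1) v / ((1 + q v) (1 + v))], comparable to [min v v^-1]; the
     constant comes from bounding both factors below, separately for small and for large [v]. *)
  have -> : 4 * q / (q - 1) * (q * v / (1 + q * v) - v / (1 + v)) =
     4 * q * v / ((1 + q * v) * (1 + v)).
    field; apply/and3P; split; first by apply: lt0r_neq0; lra.
      apply: lt0r_neq0; nra.
    apply: lt0r_neq0; nra.
  have p1 : 0 < (1 + q * v) * (1 + v) by nra.
  rewrite ler_pdivlMr//; have [v1|v1] := leP v v^-1.
    have vv : v <= 1.
      rewrite leNgt; apply/negP => h1.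
      have : v^-1 < 1 by rewrite invf_lt1.
      lra.
    have h1 : 1 + q * v <= 2 * q by nra.
    have h2 : 1 + v <= 2 by lra.
    have : (1 + q * v) * (1 + v) <= 2 * q * 2 by apply: ler_pM => //; nra.
    rewrite [2 * q * 2](_ : _ = 4 * q); last by ring.
    by move=> hh; rewrite mulrC ler_wpM2r// ltW.
  have vv : 1 <= v.
    rewrite leNgt; apply/negP => h1.
    have : 1 < v^-1 by rewrite invf_gt1.
    lra.
  rewrite mulrC ler_pdivrMr//.
  have h1 : 1 + q * v <= 2 * (q * v) by nra.
  have h2 : 1 + v <= 2 * v by lra.
  have : (1 + q * v) * (1 + v) <= 2 * (q * v) * (2 * v) by apply: ler_pM => //; nra.
  lra.
exists (4 * q / (q - 1)).
  by rewrite divr_gt0; lra.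
move=> x k0 k1 x0; set A := 4 * q / (q - 1).
have A0 : 0 < A by rewrite /A divr_gt0; lra.
have tele n : \sum_(k0 <= k < n) (2 ^+ k) `^ (- delta) * Num.min 1 ((2 ^+ k * x) ^+ m)
   <= x `^ delta * (A * (if (k0 <= n)%N then f (2 ^+ n * x) - f (2 ^+ k0 * x) else 0)).
  elim: n => [|n IH].
    case: leqP; last by rewrite big_geq// !mulr0.
    by rewrite leqn0 => /eqP ->; rewrite big_geq// subrr !mulr0.
  case: (leqP k0 n.+1) => [|h]; last by rewrite big_geq ?mulr0// ltnW.
  rewrite leq_eqVlt => /predU1P[->|]; first by rewrite big_geq// subrr !mulr0.
  rewrite ltnS => h; rewrite big_nat_recr//=.
  rewrite h in IH.
  have t0 : 0 < 2 ^+ n * x by rewrite mulr_gt0// exprn_gt0.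
  have := step _ t0; rewrite powRM ?exprn_ge0 ?(ltW x0)// -/A => st.
  have xd : x `^ delta * x `^ (- delta) = 1.
    by rewrite powRN mulfV// lt0r_neq0// powR_gt0.
  have : x `^ delta * ((2 ^+ n) `^ (- delta) * x `^ (- delta) *
     Num.min 1 ((2 ^+ n * x) ^+ m)) <=
     x `^ delta * (A * (f (2 * (2 ^+ n * x)) - f (2 ^+ n * x))).
    by rewrite ler_wpM2l ?powR_ge0.
  have -> : x `^ delta * ((2 ^+ n) `^ (- delta) * x `^ (- delta) *
     Num.min 1 ((2 ^+ n * x) ^+ m)) =
     (2 ^+ n) `^ (- delta) * Num.min 1 ((2 ^+ n * x) ^+ m) * (x `^ delta * x `^ (- delta)).
    ring.
  rewrite xd mulr1 [2 * (2 ^+ n * x)]mulrA -exprS => st2.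
  apply: (le_trans (lerD IH st2)).
  by rewrite -!mulrDr addrC addrA subrK.
apply: (le_trans (tele k1)); rewrite mulrC ler_wpM2r ?powR_ge0//.
case: leqP => _; last by rewrite mulr0 ltW.
rewrite ler_piMr ?(ltW A0)//.
have := f1 (2 ^+ k1 * x); have := f0 (2 ^+ k0 * x); lra.
Qed.

End DyadicSum.

(** * The test functions *)

Section TestFunction.
Context {R : realType}.
Implicit Types (mu nu x y t N Rr : R).

(** [Phi mu t = jb mu (2 sqrt t)]. Only a lower bound on [t] enters, so the estimate is uniform on
    the segment between two nodes, as the Taylor remainder needs. *)
Lemma Phi_decay mu : - 2^-1 < mu -> exists2 D : R, 0 < D &
  forall Rr x t, 0 <= Rr * x -> (Rr * x / 4) ^+ 2 <= t ->
    `|Phi mu t| <= D * (1 + Rr * x) `^ (- (mu + 2^-1)).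
Proof.
move=> mu2; have [C C0 hC] := jb_decay mu2.
have k0 : 0 <= mu + 2^-1 by lra.
exists (C * 2 `^ (mu + 2^-1)); first by rewrite mulr_gt0 ?powR_gt0.
move=> Rr x t; move: (Rr * x) => r r0 rt.
have t0 : 0 <= t by rewrite (le_trans _ rt)// sqr_ge0.
pose z := 2 * Num.sqrt t.
have z0 : 0 <= z by rewrite mulr_ge0 ?sqrtr_ge0.
have rz : r / 2 <= z.
  have : r / 4 <= Num.sqrt t.
    by rewrite -[leLHS]ger0_norm ?divr_ge0// -sqrtr_sqr ler_wsqrtr.
  by rewrite /z; lra.
have -> : Phi mu t = jb mu z.
  by rewrite /jb /z [2 * _]mulrC mulfK// sqr_sqrtr.
apply: (le_trans (hC z z0)).
rewrite -mulrA ler_wpM2l ?(ltW C0)// !powRN.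
have p1 : 0 < (1 + r) `^ (mu + 2^-1) by apply: powR_gt0; lra.
have p2 : 0 < (1 + z) `^ (mu + 2^-1) by apply: powR_gt0; lra.
rewrite ler_pdivlMr// mulrC ler_pdivrMr// -powRM//; last by lra.
by apply: (ge0_ler_powR k0); rewrite ?nnegrE; lra.
Qed.

(** Bounding each term by its decay gives the factor [1]. For [(N x)^m]: extrapolation is exact on
    the Taylor polynomial at [s0^2 x^2 / 4], leaving remainders of size
    [(N Rr x^2)^m (1 + Rr x)^(- nu - m - 1/2)]. *)
Lemma extrap_jb_bound nu (m : nat) : - 2^-1 < nu -> (0 < m)%N ->
  exists2 C : R, 0 < C & forall Rr N s0 (s : nat -> R),
    0 < N -> 4 * N <= Rr -> Rr - 2 * N <= s0 <= Rr - N ->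
    (forall i : nat, Rr + 2 * i%:R * N <= s i <= Rr + (2 * i%:R + 1) * N) ->
    forall x, 0 < x ->
    `|jb nu (s0 * x) - \sum_(i < m) extrap_weight (s0 ^+ 2) (fun j => s j ^+ 2) i *
        jb nu (s i * x)|
    <= C * Num.min 1 ((N * x) ^+ m) * (1 + Rr * x) `^ (- (nu + 2^-1)).
Proof.
move=> nu2 m0; have nu1 : -1 < nu by lra.
have num : - 2^-1 < nu + m%:R by rewrite ltr_wpDr.
have [D D0 hD] := Phi_decay nu2; have [D' D'0 hD'] := Phi_decay num.
(* [K] bounds the ratio of [|s0^2 - s_j^2| <= (2 m + 1) N (2 m + 2) Rr] to [N Rr], a lower bound for
   the separation of the squared nodes. *)
pose K : R := (2 * m%:R + 1) * (2 * m%:R + 2).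
have mR : 1 <= m%:R :> R by rewrite ler1n.
have K1 : 1 <= K by rewrite /K; nra.
have K0 : 0 <= K by lra.
have C10 : 0 < (1 + m%:R * K ^+ m) * D.
  by rewrite mulr_gt0// ltr_pwDl// mulr_ge0// exprn_ge0.
have C20 : 0 <= m%:R * K ^+ m * K ^+ m * D'.
  by rewrite !mulr_ge0 ?exprn_ge0// ltW.
exists ((1 + m%:R * K ^+ m) * D + m%:R * K ^+ m * K ^+ m * D').
  by rewrite ltr_wpDr.
move=> Rr N s0 s N0 NR /andP[s01 s02] sb x x0.
have Rr0 : 0 < Rr by lra.
have iN (i : nat) : 0 <= i%:R :> R by [].
have sR i : Rr <= s i.
  have /andP[h _] := sb i; apply: le_trans h; rewrite lerDl.
  by rewrite !mulr_ge0// ltW.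
have sdiff i j : (j < i)%N -> N * Rr <= s i ^+ 2 - s j ^+ 2.
  move=> ji; have /andP[h1 h2] := sb i; have /andP[h3 h4] := sb j.
  have ijR : j%:R + 1 <= i%:R :> R by rewrite natr1 ler_nat.
  have d1 : N <= s i - s j by nra.
  have := sR i; have := sR j; rewrite subr_sqr.
  clear - N0 Rr0 d1 => sj si.
  by apply: ler_pM => //; lra.
have sdist i j : i != j -> N * Rr <= `|s i ^+ 2 - s j ^+ 2|.
  rewrite neq_ltn => /orP[h|h].
    by rewrite distrC (le_trans (sdiff _ _ h))// ler_norm.
  by rewrite (le_trans (sdiff _ _ h))// ler_norm.
have NR0 : 0 < N * Rr by rewrite mulr_gt0.
have sinj : injective (fun j => s j ^+ 2).
  move=> i j /= e; apply/eqP; apply/negPn/negP => /sdist.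
  by rewrite e subrr normr0 leNgt NR0.
have s0dist j : (j < m)%N -> `|s0 ^+ 2 - s j ^+ 2| <= K * (N * Rr).
  move=> jm; have /andP[h1 h2] := sb j; have sj := sR j.
  have jR : j%:R + 1 <= m%:R :> R by rewrite natr1 ler_nat.
  rewrite distrC subr_sqr normrM.
  have -> : K * (N * Rr) = ((2 * m%:R + 1) * N) * ((2 * m%:R + 2) * Rr).
    by rewrite /K; ring.
  apply: ler_pM => //.
    by clear - h1 h2 jR N0 sj s01 s02; rewrite ger0_norm; nra.
  by clear - h1 h2 jR mR N0 NR Rr0 sj s01 s02; rewrite ger0_norm; nra.
pose L := extrap_weight (m := m) (s0 ^+ 2) (fun j => s j ^+ 2); rewrite -/L.
have LK i : `|L i| <= K ^+ m.
  apply: extrap_bound => // j jm ji.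
  apply: (le_trans (s0dist _ jm)); rewrite ler_wpM2l//.
  by apply: sdist; rewrite eq_sym.
pose c := x ^+ 2 / 4; have c0 : 0 < c by rewrite divr_gt0// exprn_gt0.
have jE z : jb nu (z * x) = Phi nu (z ^+ 2 * c).
  by rewrite /jb /c; congr Phi; field.
have Rx : 0 <= Rr * x by apply: mulr_ge0; exact: ltW.
have low z : Rr / 2 <= z -> (Rr * x / 4) ^+ 2 <= z ^+ 2 * c.
  move=> h; have -> : z ^+ 2 * c = (z * x / 2) ^+ 2 by rewrite /c; field.
  have zx : Rr / 2 * x <= z * x by rewrite ler_wpM2r// ltW.
  rewrite lerXn2r ?nnegrE//; first by clear - Rx; lra.
    by clear - Rx zx; lra.
  by clear - Rx zx; lra.
have low0 : (Rr * x / 4) ^+ 2 <= s0 ^+ 2 * c by apply: low; lra.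
have lowi i : (Rr * x / 4) ^+ 2 <= s i ^+ 2 * c by apply: low; have := sR i; lra.
set P := (1 + Rr * x) `^ (- (nu + 2^-1)).
have P0 : 0 < P by apply: powR_gt0; lra.
have bound1 : `|jb nu (s0 * x) - \sum_(i < m) L i * jb nu (s i * x)| <=
    (1 + m%:R * K ^+ m) * D * P.
  apply: (le_trans (ler_normB _ _)).
  have -> : (1 + m%:R * K ^+ m) * D * P = D * P + \sum_(i < m) K ^+ m * (D * P).
    by rewrite sumr_const card_ord -mulr_natl; ring.
  apply: lerD; first by rewrite jE; apply: hD.
  apply: (le_trans (ler_norm_sum _ _ _)); apply: ler_sum => i _.
  by rewrite normrM ler_pM// jE; apply: hD.
have [p sp hp] := Phi_taylor m (s0 ^+ 2 * c) nu1.
pose M := D' * (1 + Rr * x) `^ (- (nu + m%:R + 2^-1)).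
have hM z : (Rr * x / 4) ^+ 2 <= z ^+ 2 * c ->
    `|Phi nu (z ^+ 2 * c) - p.[z ^+ 2 * c]| <= M * `|z ^+ 2 * c - s0 ^+ 2 * c| ^+ m.
  move=> lz; apply: hp => t /andP[t1 _]; apply: hD' => //.
  by apply: le_trans t1; rewrite le_min low0.
have M0 : 0 <= M by rewrite mulr_ge0 ?powR_ge0// ltW.
have bound2 : `|jb nu (s0 * x) - \sum_(i < m) L i * jb nu (s i * x)| <=
    m%:R * K ^+ m * K ^+ m * D' * ((N * x) ^+ m * P).
  (* At its own center the remainder bound carries [0^m = 0], since [m > 0]. *)
  have e0 : jb nu (s0 * x) = p.[s0 ^+ 2 * c].
    apply/eqP; rewrite jE -subr_eq0 -normr_le0 (le_trans (hM _ low0))//.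
    by rewrite subrr normr0 expr0n -[m == 0%N]negbK -lt0n m0/= mulr0.
  have yinj : injective (fun j => s j ^+ 2 * c).
    by move=> i j /(mulIf (lt0r_neq0 c0)); exact: sinj.
  rewrite e0 (extrap_poly _ m0 yinj sp) -sumrB.
  apply: (@le_trans _ _ (\sum_(i < m) K ^+ m * (M * (K * (N * Rr) * c) ^+ m))).
    apply: (le_trans (ler_norm_sum _ _ _)); apply: ler_sum => i _.
    rewrite (extrap_scale _ _ (lt0r_neq0 c0) sinj) -/L -mulrBr normrM ler_pM//.
    rewrite distrC jE (le_trans (hM _ (lowi i)))// ler_wpM2l//.
    have KN0 : 0 <= K * (N * Rr) * c.
      by apply: mulr_ge0; [apply: mulr_ge0; [exact: K0|exact: ltW]|exact: ltW].
    apply: lerXn2r; rewrite ?nnegrE//.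
    rewrite -mulrBl normrM (gtr0_norm c0) ler_wpM2r ?(ltW c0)//.
    by rewrite distrC s0dist.
  rewrite sumr_const card_ord -[leLHS]mulr_natl /M.
  (* The [m] extra powers of decay absorb [(Rr x)^m], turning [(N Rr x^2)^m] into [(N x)^m]. *)
  have -> : (1 + Rr * x) `^ (- (nu + m%:R + 2^-1)) = P * ((1 + Rr * x) ^+ m)^-1.
    have r1 : 1 + Rr * x != 0 by rewrite lt0r_neq0// ltr_pwDl.
    rewrite /P (_ : - (nu + m%:R + 2^-1) = - (nu + 2^-1) + - m%:R); last by ring.
    by rewrite powRD ?r1 ?implybT// powR_invn// addr_ge0.
  have e1 : (K * (N * Rr) * c) ^+ m = K ^+ m * (N * x) ^+ m * ((Rr * x) / 4) ^+ m.
    by rewrite -!exprMn /c; congr (_ ^+ m); field.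
  rewrite e1.
  have q1 : ((Rr * x) / 4) ^+ m * ((1 + Rr * x) ^+ m)^-1 <= 1.
    rewrite ler_pdivrMr ?exprn_gt0 ?ltr_pwDl//.
    by rewrite mul1r lerXn2r ?nnegrE//; clear - Rx; lra.
  have q0 : 0 <= m%:R * K ^+ m * K ^+ m * D' * ((N * x) ^+ m * P).
    by rewrite mulr_ge0// mulr_ge0 ?(ltW P0)// exprn_ge0// mulr_ge0// ltW.
  have := ler_wpM2l q0 q1; rewrite [leRHS]mulr1; apply: le_trans.
  by rewrite le_eqVlt; apply/orP; left; apply/eqP; ring.
set G := `|_|.
rewrite -mulrA mulrDl minEle; case: ifP => _.
  rewrite mul1r (le_trans bound1)// lerDl.
  by rewrite mulr_ge0// ltW.
rewrite (le_trans bound2)// lerDr.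
by rewrite mulr_ge0 ?(ltW C10)// mulr_ge0 ?(ltW P0)// exprn_ge0// mulr_ge0// ltW.
Qed.

End TestFunction.

(** * Zeros near [Rr] and the pairing with the test functions *)

Section TestPairing.
Context {R : realType}.
Variables (nu : R) (s : nat -> R).
Hypothesis nu_gt : - (1 / 2) < nu.
Hypothesis sP : bessel_zeros nu s.
Implicit Types (x N Rr delta : R).
Local Notation leb := (@lebesgue_measure R).
Local Notation Int f := (\int[leb]_(x in `]0%R, 1%R[) (f : R -> R) x).
Local Notation mult delta Rr l :=
  (Num.max (1 - s l ^+ 2 / Rr ^+ 2) 0 `^ delta).

Let nu2 : - 2^-1 < nu. Proof. by have := nu_gt; lra. Qed.
Let nu1 : -1 < nu. Proof. by have := nu_gt; lra. Qed.

Lemma zero_exists : exists2 Z : R, 0 < Z & forall z N, Z <= z -> 2 * pi <= N ->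
  exists j, z <= s j <= z + N.
Proof.
have [Z Z0 hZ] := jb_zero_exists nu2; exists Z => // z N Zz piN.
have [x /andP[zx xz] jx] := hZ z Zz.
have [_ _ _ hs] := sP.
have x0 : 0 < x by lra.
have bx : besselJ nu x = 0 by rewrite besselJE// [Phi _ _]jx mulr0.
have [j e] := hs x x0 bx.
by exists j; rewrite e zx (le_trans xz)// lerD2l.
Qed.

(** From [s l <= Rr - N], [1 - (s l / Rr)^2 >= 1 - s l / Rr >= N / Rr]. With the weight [N^-delta]
    all scales contribute alike. *)
Lemma mult_lower_bound delta Rr N l : 0 < delta -> 0 < N -> N <= Rr ->
  s l <= Rr - N -> Rr `^ (- delta) <= N `^ (- delta) * mult delta Rr l.
Proof.
move=> d0 N0 NR sN; have [s0 _ _ _] := sP; have sl := s0 l.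
have Rr0 : 0 < Rr by lra.
have -> : Rr `^ (- delta) = N `^ (- delta) * (N / Rr) `^ delta.
  rewrite powRM ?invr_ge0 ?(ltW N0) ?(ltW Rr0)// mulrA [N `^ (- delta)]powRN mulVf; last first.
    by rewrite lt0r_neq0// powR_gt0.
  by rewrite mul1r -(powR_inv1 (ltW Rr0)) -powRrM mulN1r.
rewrite ler_wpM2l ?powR_ge0//.
apply: (ge0_ler_powR (ltW d0)); rewrite ?nnegrE.
- by rewrite divr_ge0 ?ltW.
- by rewrite le_max lexx orbT.
rewrite le_max; apply/orP; left.
rewrite ler_pdivrMr// mulrBl mul1r.
have -> : s l ^+ 2 / Rr ^+ 2 * Rr = s l * (s l / Rr) by field; lra.
have : s l * (s l / Rr) <= s l * 1.
  by rewrite ler_wpM2l ?(ltW sl)// ler_pdivrMr//; lra.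
lra.
Qed.

Lemma mult_eq0 delta Rr l : 0 < delta -> 0 < Rr -> Rr <= s l -> mult delta Rr l = 0.
Proof.
move=> d0 R0 Rs; rewrite max_r ?powR0 ?lt0r_neq0//.
rewrite subr_le0 ler_pdivlMr ?exprn_gt0// mul1r lerXn2r ?nnegrE; lra.
Qed.

(** [B] stands for a Bochner-Riesz mean and [I a] for the pairing of its input with [jb nu (a x)];
    the input is left open, so [g] does not depend on it. *)
Lemma test_function delta : 0 < delta -> exists C c : R, [/\ 0 < C, 0 < c &
  \forall Rr \near +oo, exists g : R -> R, [/\ continuous g,
    forall x, 0 < x ->
      `|g x| <= C * x `^ delta * (1 + Rr * x) `^ (- (nu + 2^-1)) &
    forall (B : R -> R) (I : R -> R) q, continuous B ->
      (forall l, Int (fun x : R => B x * (jb nu (s l * x) * cwgt nu x)) =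
         mult delta Rr l * I (s l)) ->
      0 <= q -> (forall a, 0 <= a <= Rr -> q <= I a) ->
      c * ln Rr * Rr `^ (- delta) * q <=
        Int (fun x : R => B x * (g x * cwgt nu x))]].
Proof.
move=> d0; pose m := (Num.truncn delta).+1.
have dm : delta < m%:R by exact: truncnS_gt.
have m0 : (0 < m)%N by [].
have [C1 C10 hC1] := extrap_jb_bound nu2 m0.
have [C2 C20 hC2] := @dyadic_sum _ delta m ltac:(by rewrite d0).
have [Z Z0 hZ] := zero_exists.
(* From [k0] on, [2^k >= 2 pi], so every interval of length [2^k] beyond [Z] contains a zero. *)
pose k0 := (Num.truncn (2 * pi : R)).+1.
have k0pi k : (k0 <= k)%N -> 2 * pi <= 2 ^+ k :> R.
  move=> k0k; apply: (@le_trans _ _ k0%:R); first exact/ltW/truncnS_gt.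
  apply: (@le_trans _ _ k%:R); first by rewrite ler_nat.
  by rewrite -natrX ler_nat ltnW// ltn_expl.
(* [C1] comes from the extrapolation at each scale, [C2] from the dyadic sum; [1/4] works because
   [k1 - k0 >= ln Rr / 4] once [ln Rr >= 4 (k0 + 1)]. *)
exists (C1 * C2), 4^-1; split; [exact: mulr_gt0|by []|].
near=> Rr.
have Rr1 : 1 < Rr by near: Rr; exact: nbhs_pinfty_gt.
have Rr64 : 64 <= Rr by near: Rr; apply: nbhs_pinfty_ge; exact: num_real.
have RrZ : 2 * Z <= Rr by near: Rr; apply: nbhs_pinfty_ge; exact: num_real.
have Rrk : expR (4 * (k0%:R + 1)) <= Rr.
  by near: Rr; apply: nbhs_pinfty_ge; exact: num_real.
have Rr0 : 0 < Rr by lra.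
(* Scales [k < k1] satisfy [2^k <= exp (ln Rr / 2) = sqrt Rr], hence [4 * 2^k <= Rr] as
   [Rr >= 64]. *)
pose k1 := Num.truncn (ln Rr / 2).
have lnR0 : 0 <= ln Rr by apply: ln_ge0; lra.
have k1le : k1%:R <= ln Rr / 2 by rewrite truncn_le; lra.
have k1gt : ln Rr / 2 < k1%:R + 1 by rewrite natr1; exact: truncnS_gt.
have lnRk : 4 * (k0%:R + 1) <= ln Rr by rewrite -ler_expR lnK// posrE.
have N4 k : (k < k1)%N -> 4 * 2 ^+ k <= Rr.
  move=> kk1; have : (2 : R) ^+ k <= expR (ln Rr / 2).
    apply: (@le_trans _ _ (expR k%:R)).
      rewrite -[k%:R]mulr1 expRM_natl lerXn2r ?nnegrE ?expR_ge0//.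
      by have := expR_ge1Dx (1:R); lra.
    by rewrite ler_expR (le_trans _ k1le)// ler_nat ltnW.
  have e : expR (ln Rr / 2) * expR (ln Rr / 2) = Rr.
    rewrite -expRD -splitr lnK//.
  have := expR_gt0 (ln Rr / 2); move: e; move: (expR _) (2 ^+ k) => v u e v0 uv.
  have : 8 <= v by nra.
  nra.
(* [p.1] indexes the zero below [Rr], [p.2] the nodes above it; outside the range of scales a dummy
   pair keeps the choice total. *)
have hk k : exists p : nat * (nat -> nat), (k0 <= k < k1)%N ->
   [/\ Rr - 2 * 2 ^+ k <= s p.1 <= Rr - 2 ^+ k &
     forall i : nat, Rr + 2 * i%:R * 2 ^+ k <= s (p.2 i)
       <= Rr + (2 * i%:R + 1) * 2 ^+ k].
  have [/andP[kk0 kk1]|_] := boolP (k0 <= k < k1)%N; last by exists (0%N, id).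
  have Npi := k0pi k kk0; have NR := N4 k kk1.
  have N0 : 0 < (2 : R) ^+ k by exact: exprn_gt0.
  have [|l0 hl0] := hZ (Rr - 2 * 2 ^+ k) (2 ^+ k) _ Npi; first by lra.
  have [l hl] : exists l : nat -> nat, forall i : nat,
      Rr + 2 * i%:R * 2 ^+ k <= s (l i) <= Rr + 2 * i%:R * 2 ^+ k + 2 ^+ k.
    suff /choice[l hl] : forall i : nat, exists j,
        Rr + 2 * i%:R * 2 ^+ k <= s j <= Rr + 2 * i%:R * 2 ^+ k + 2 ^+ k.
      by exists l.
    move=> i.
    apply: hZ => //; have : 0 <= 2 * i%:R * 2 ^+ k :> R by rewrite !mulr_ge0// ltW.
    lra.
  exists (l0, l) => _ /=; split.
    by move: hl0 => /andP[h1 h2]; apply/andP; split; lra.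
  by move=> i; have /andP[h1 h2] := hl i; apply/andP; split; lra.
have [p hp] := choice hk.
pose sig0 k := s (p k).1; pose sig k i := s ((p k).2 i).
pose L k (i : 'I_m) := extrap_weight (sig0 k ^+ 2) (fun j => sig k j ^+ 2) i.
pose G k x := jb nu (sig0 k * x) - \sum_(i < m) L k i * jb nu (sig k i * x).
pose g x := \sum_(k0 <= k < k1) (2 ^+ k) `^ (- delta) * G k x.
have cj a : continuous (fun x : R => jb nu (a * x)).
  move=> x; apply: (@continuous_comp _ _ _ (fun x : R => a * x) (jb nu)).
    by apply: cvgM; [exact: cvg_cst | exact: cvg_id].
  exact: jb_continuous.
have cg : continuous g.
  apply: continuous_sumf => k; apply: continuous_scalef.
  apply: continuous_subf => //; apply: continuous_sumf => i.
  exact: continuous_scalef.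
exists g; split => //.
- move=> x x0; rewrite /g big_seq_cond.
  set P := (1 + Rr * x) `^ _.
  apply: (le_trans (ler_norm_sum _ _ _)).
  apply: (@le_trans _ _ (\sum_(k0 <= k < k1) C1 * P *
      ((2 ^+ k) `^ (- delta) * Num.min 1 ((2 ^+ k * x) ^+ m)))).
    rewrite [leRHS]big_seq_cond; apply: ler_sum => k.
    rewrite mem_index_iota andbT => kk; have [h1 h2] := hp k kk.
    rewrite normrM (ger0_norm (powR_ge0 _ _)).
    rewrite mulrCA ler_wpM2l ?powR_ge0//.
    have /andP[_ kk1] := kk.
    have := hC1 Rr (2 ^+ k) (sig0 k) (sig k) (exprn_gt0 _ _) (N4 k kk1) h1 h2 x x0.
    by rewrite -/P mulrAC; apply.
  rewrite -mulr_sumr.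
  have P0 : 0 <= C1 * P by rewrite mulr_ge0 ?powR_ge0// ltW.
  apply: (le_trans (ler_wpM2l P0 (hC2 x k0 k1 x0))).
  by rewrite le_eqVlt; apply/orP; left; apply/eqP; ring.
- move=> B I q cB hB q0 hI.
  have cBj a : continuous (fun x : R => B x * (jb nu (a * x) * cwgt nu x)).
    apply: continuous_mulf => //; apply: continuous_mulf => //.
    exact: cwgt_continuous.
  have ci a := continuous_integrable_oo 0 1 (cBj a).
  have GE k : Int (fun x : R => B x * (G k x * cwgt nu x)) =
      mult delta Rr (p k).1 * I (sig0 k) -
      \sum_(i < m) L k i * (mult delta Rr ((p k).2 i) * I (sig k i)).
    rewrite (eq_Rintegral leb (g := fun x => B x * (jb nu (sig0 k * x) * cwgt nu x) -
       \sum_(i < m) L k i * (B x * (jb nu (sig k i * x) * cwgt nu x)))); last first.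
      move=> x _; rewrite /G mulrBl mulrBr mulr_suml mulr_sumr; congr (_ - _).
      by apply: eq_bigr => i _; rewrite !mulrA [B x * L k i]mulrC.
    rewrite RintegralB//; last first.
      apply: continuous_integrable_oo; apply: continuous_sumf => i.
      exact: continuous_scalef.
    rewrite hB Rintegral_sum_oo; last by move=> i; exact: continuous_scalef.
    by congr (_ - _); apply: eq_bigr => i _; rewrite RintegralZl// hB.
  have gE : Int (fun x : R => B x * (g x * cwgt nu x)) =
      \sum_(k0 <= k < k1) (2 ^+ k) `^ (- delta) *
         Int (fun x : R => B x * (G k x * cwgt nu x)).
    have cG k : continuous (fun x : R => B x * (G k x * cwgt nu x)).
      apply: continuous_mulf => //; apply: continuous_mulf; last exact: cwgt_continuous.
      by apply: continuous_subf => //; apply: continuous_sumf => i;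
        exact: continuous_scalef.
    rewrite (eq_Rintegral leb (g := fun x => \sum_(k0 <= k < k1)
       (2 ^+ k) `^ (- delta) * (B x * (G k x * cwgt nu x)))); last first.
      move=> x _; rewrite /g mulr_suml mulr_sumr.
      by apply: eq_bigr => k _; rewrite !mulrA [B x * _]mulrC.
    rewrite Rintegral_sum_oo; last by move=> k; exact: continuous_scalef.
    apply: eq_bigr => k _; rewrite RintegralZl//.
    exact: continuous_integrable_oo.
  rewrite gE.
  apply: (@le_trans _ _ (\sum_(k0 <= k < k1) Rr `^ (- delta) * q)).
    rewrite sumr_const_nat -[leRHS]mulr_natl [leRHS]mulrA.
    rewrite ler_wpM2r// ler_wpM2r ?powR_ge0//.
    have kk : (k0 <= k1)%N.
      by rewrite -(ler_nat R); lra.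
    by rewrite natrB//; lra.
  rewrite big_seq_cond [leRHS]big_seq_cond; apply: ler_sum => k.
  rewrite mem_index_iota andbT => kk; have [/andP[h1 h2] h3] := hp k kk.
  have /andP[kk0 kk1] := kk.
  have N0 : 0 < (2 : R) ^+ k by exact: exprn_gt0.
  have NR := N4 k kk1.
  (* Every node lies at or beyond [Rr], so the multiplier removes all extrapolation terms. *)
  rewrite GE big1 ?subr0; last first.
    move=> i _; rewrite mult_eq0 ?mul0r ?mulr0//.
    have /andP[h _] := h3 i; apply: le_trans h; rewrite lerDl.
    by rewrite !mulr_ge0// ltW.
  rewrite mulrA ler_pM ?powR_ge0//.
    by apply: mult_lower_bound => //; lra.
  have [s0 _ _ _] := sP; have := s0 (p k).1 => sp.
  by apply: hI; rewrite /sig0 (ltW sp)/=; lra.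
Unshelve. all: by end_near. Qed.

End TestPairing.

(** * The lower bound *)

Section LowerBound.
Context {R : realType}.
Variables (nu : R) (s : nat -> R).
Hypothesis nu_gt : - (1 / 2) < nu.
Hypothesis sP : bessel_zeros nu s.
Local Notation leb := (@lebesgue_measure R).
Local Notation Int f := (\int[leb]_(x in `]0%R, 1%R[) (f : R -> R) x).

(** The convex function [t^p] lies above its tangent at [b]. The case [p = 1] is separate because
    its conjugate exponent is infinite. *)
Lemma young_powR (p t b : R) : 1 <= p -> 0 <= t -> 0 < b ->
  p * b `^ (p - 1) * t - (p - 1) * b `^ p <= t `^ p.
Proof.
move=> p1 t0 b0; have [->|pN1] := eqVneq p 1.
  by rewrite subrr powRr0 mul0r subr0 !mul1r powRr1.
have p1' : 0 < p - 1 by rewrite subr_gt0 lt_neqAle eq_sym pN1.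
have p0 : 0 < p by lra.
have q0 : 0 < p / (p - 1) by rewrite divr_gt0.
have := @conjugate_powR _ t (b `^ (p - 1)) p (p / (p - 1)) t0 (powR_ge0 _ _) p0 q0.
rewrite -powRrM.
have -> : (p - 1) * (p / (p - 1)) = p by field; lra.
have -> : p^-1 + (p / (p - 1))^-1 = 1 by field; lra.
move=> /(_ erefl) h.
have := ler_wpM2l (ltW p0) h.
have -> : p * (t `^ p / p + b `^ p / (p / (p - 1))) =
   t `^ p + (p - 1) * b `^ p by field; lra.
lra.
Qed.

Lemma Rintegral_inv1Dx (r : R) : 0 < r ->
  Int (fun x : R => (1 + r * `|x|)^-1) = ln (1 + r) / r.
Proof.
move=> r0.
rewrite (eq_Rintegral leb (g := fun x : R => (1 + r * x)^-1)); last first.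
  by move=> x; rewrite inE/= in_itv/= => /andP[x0 _]; rewrite gtr0_norm.
pose F (x : R) := r^-1 * ln (1 + r * x).
have pos (x : R) : 0 <= x -> 0 < 1 + r * x.
  by move=> x0; have := mulr_ge0 (ltW r0) x0; lra.
have d1 (x : R) : is_derive x 1 (fun x : R => 1 + r * x) r.
  apply: (is_derive_eq (is_derive_add (f := fun=> 1)
    (is_derive_cst (1 : R) x (1:R)) (is_derive_scale r (is_derive_id x (1:R))))).
  by rewrite add0r mulr1.
have dF (x : R) : 0 <= x -> is_derive x 1 F (1 + r * x)^-1.
  move=> x0; have := is_derive_scale r^-1 (is_derive_comp
    (g := fun x : R => 1 + r * x) (is_derive1_ln (pos x x0)) (d1 x)).
  by move=> h; apply: (is_derive_eq h); field; rewrite !lt0r_neq0// pos.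
have -> : ln (1 + r) / r = F 1 - F 0.
  by rewrite /F mulr0 addr0 ln1 mulr0 subr0 mulr1 mulrC.
apply: continuous_FTC2_oo => //.
- move=> x /andP[x0 _]; apply: cvgV; first by rewrite lt0r_neq0// pos.
  exact: (is_derive_continuous (d1 x)).
- by move=> x /andP[x0 _]; exact: (is_derive_continuous (dF x x0)).
- by move=> x /andP[x0 _]; apply: dF; exact: ltW.
Qed.

(** Both regimes are covered at once: [p > 1] for [delta < nu + 1/2], and [p = 1] at equality. *)
Lemma bochner_riesz_indic_lower_bound delta :
  0 < delta <= nu + 1 / 2 ->
  let p := 4 * (nu + 1) / (2 * nu + 3 + 2 * delta) in
  exists2 c : R, 0 < c & \forall Rr \near +oo, exists eta : R, exists B : R -> R,
    [/\ 0 < eta <= 1, continuous B,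
      forall k x, 0 < x -> bochner_riesz nu s delta Rr
        (fun y => k * \1_(`]0%R, eta[ : set R) y) x = k * B x &
      c * ln Rr * mass nu eta <= Int (fun x : R => `|B x| `^ p * cwgt nu x)].
Proof.
move=> /andP[d0 dnu] p; have nu_gt' := nu_gt.
have k0 : 0 <= 2 * nu + 1 by lra.
have nu1 : -1 < nu by lra.
(* The comparison function is [(1 + Rr x)^-a]: its power [p] has exponent [- (2 nu + 2)], critical
   for the weight, and its power [p - 1] matches the decay of [g]. *)
pose a := nu + 3 / 2 + delta.
have a0 : 0 < a by rewrite /a; lra.
have pE : p = (2 * nu + 2) / a by rewrite /p /a; field; lra.
clearbody p.
have ap : a * p = 2 * nu + 2 by rewrite pE; field; lra.
have p1 : 1 <= p by rewrite pE ler_pdivlMr//; rewrite /a; lra.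
have p0 : 0 < p by lra.
have ap1 : a * (p - 1) = nu + 2^-1 - delta by rewrite mulrBr ap /a; field.
have [C [c1 [C0 c10 testP]]] := test_function nu_gt sP d0.
have [c /andP[c0 c1'] hc] := jb_lower_bound nu_gt.
have [Z Z0 hZ] := zero_exists nu_gt sP.
have j0 := jb0_gt0 nu_gt.
pose kap := c `^ (2 * nu + 2) / (2 * nu + 2).
have kap0 : 0 < kap by rewrite divr_gt0 ?powR_gt0//; lra.
pose D := p * c1 * jb nu 0 / (2 * C).
have D0 : 0 < D by rewrite divr_gt0// !mulr_gt0.
(* Young's loss carries one more factor [eps] than the gain; this value makes the loss at most half
   of the gain. *)
pose eps := D * kap / (4 * p).
have eps0 : 0 < eps by rewrite divr_gt0// mulr_gt0.
have ep1 : 0 < eps `^ (p - 1) by rewrite powR_gt0.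
exists (eps `^ (p - 1) * (D / 2)).
  by rewrite mulr_gt0// divr_gt0.
near=> Rr.
have Rr2 : 2 <= Rr by near: Rr; apply: nbhs_pinfty_ge; exact: num_real.
have RrZ : Z <= Rr by near: Rr; apply: nbhs_pinfty_ge; exact: num_real.
have Rr0 : 0 < Rr by lra.
have [g [cg gb gB]] : exists g : R -> R, [/\ continuous g,
    forall x, 0 < x ->
      `|g x| <= C * x `^ delta * (1 + Rr * x) `^ (- (nu + 2^-1)) &
    forall (B : R -> R) (I : R -> R) q, continuous B ->
      (forall l, Int (fun x : R => B x * (jb nu (s l * x) * cwgt nu x)) =
         Num.max (1 - s l ^+ 2 / Rr ^+ 2) 0 `^ delta * I (s l)) ->
      0 <= q -> (forall a, 0 <= a <= Rr -> q <= I a) ->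
      c1 * ln Rr * Rr `^ (- delta) * q <=
        Int (fun x : R => B x * (g x * cwgt nu x))].
  by near: Rr; exact: testP.
pose eta := c / Rr.
have eta01 : 0 < eta <= 1.
  by rewrite divr_gt0//= ler_pdivrMr// mul1r; lra.
have /andP[eta0 _] := eta01.
have massE : mass nu eta = kap * Rr `^ (- (2 * nu + 2)).
  rewrite /mass /eta /kap powRM ?invr_ge0 ?(ltW c0) ?(ltW Rr0)//.
  by rewrite -(powR_inv1 (ltW Rr0)) -powRrM mulN1r mulrAC.
have m0 := mass_gt0 nu_gt eta0.
have dN0 : delta != 0 by rewrite lt0r_neq0.
have [n hn] : exists n, Rr <= s n.
  have [n /andP[hn _]] := hZ Rr (2 * pi) RrZ (lexx _).
  by exists n.
pose f : R -> R := \1_(`]0%R, eta[ : set R).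
have cj b : continuous (fun x : R => jb nu (b * x)).
  move=> x; apply: (@continuous_comp _ _ _ (fun x : R => b * x) (jb nu)).
    by apply: cvgM; [exact: cvg_cst | exact: cvg_id].
  exact: jb_continuous.
have cw := cwgt_continuous nu_gt.
have [|B [cB BE pairB]] := @bochner_riesz_pairing _ _ _ nu_gt sP delta Rr f dN0 Rr0
  (ex_intro _ n hn).
  by move=> b; apply: integrable_indic_oo; apply: continuous_mulf.
exists eta, B; split => //.
pose q := jb nu 0 / 2 * mass nu eta.
have q0 : 0 <= q by rewrite mulr_ge0 ?(ltW m0) ?divr_ge0 ?(ltW j0).
have hB := gB B (fun b => Int (fun x : R => f x * (jb nu (b * x) * cwgt nu x))) q cB
  pairB q0.
have {hB gB} hB : c1 * ln Rr * Rr `^ (- delta) * q <=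
   Int (fun x : R => B x * (g x * cwgt nu x)).
  apply: hB => b /andP[b0 bR]; apply: (Rintegral_indic_jb_ge nu_gt hc) => //.
  by rewrite /eta mulrA ler_pdivrMr// mulrC ler_wpM2l// ltW.
(* [K] makes [K |g|] at most the slope [p b^(p-1)] of the tangent at [b = eps (1 + Rr x)^-a], and
   [K' h] dominates the loss [(p - 1) b^p] times the weight. *)
pose K := p * eps `^ (p - 1) * (Rr `^ delta / C).
have K0 : 0 <= K by rewrite !mulr_ge0 ?powR_ge0 ?invr_ge0 ?(ltW C0) ?(ltW p0).
pose K' := (p - 1) * eps `^ p * Rr `^ (- (2 * nu + 1)).
have K'0 : 0 <= K' by rewrite !mulr_ge0 ?powR_ge0// subr_ge0.
pose h (x : R) : R := (1 + Rr * `|x|)^-1.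
have hpos (x : R) : 0 < 1 + Rr * `|x|.
  by rewrite ltr_pwDl// mulr_ge0// ltW.
have ch : continuous h.
  move=> x; apply: cvgV; first by rewrite lt0r_neq0.
  apply: cvgD; first exact: cvg_cst.
  apply: cvgM; first exact: cvg_cst.
  exact: norm_continuous.
have pointwise x : 0 < x ->
    K * (B x * (g x * cwgt nu x)) - K' * h x <= `|B x| `^ p * cwgt nu x.
  move=> x0; rewrite /h gtr0_norm//.
  have Rx : 0 < Rr * x by rewrite mulr_gt0.
  have r1 : 0 < 1 + Rr * x by rewrite addr_gt0.
  have Rxr : Rr * x <= 1 + Rr * x by rewrite lerDr.
  have r1n : (1 + Rr * x != 0) by rewrite lt0r_neq0.
  pose A := (1 + Rr * x) `^ (- a).
  have A0 : 0 < A by rewrite powR_gt0.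
  have yo := young_powR p1 (normr_ge0 (B x)) (mulr_gt0 eps0 A0).
  rewrite !(powRM _ (ltW eps0) (ltW A0)) in yo.
  have Ap1 : A `^ (p - 1) = (1 + Rr * x) `^ (- (nu + 2^-1 - delta)).
    by rewrite /A -powRrM mulNr ap1.
  have Ap : A `^ p = (1 + Rr * x) `^ (- (2 * nu + 2)).
    by rewrite /A -powRrM mulNr ap.
  have w0 := cwgt_ge0 nu x.
  have gA : g x * B x <= C * Rr `^ (- delta) * A `^ (p - 1) * `|B x|.
    apply: (le_trans (ler_norm _)); rewrite normrM ler_wpM2r//.
    apply: (le_trans (gb x x0)).
    have -> : A `^ (p - 1) = (1 + Rr * x) `^ delta * (1 + Rr * x) `^ (- (nu + 2^-1)).
      by rewrite Ap1 -powRD ?r1n ?implybT//; congr powR; ring.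
    have -> : x `^ delta = Rr `^ (- delta) * (Rr * x) `^ delta.
      rewrite powRM ?(ltW Rr0) ?(ltW x0)// mulrA powRN mulVf ?mul1r//.
      by rewrite lt0r_neq0// powR_gt0.
    rewrite -!mulrA ler_wpM2l ?(ltW C0)// ler_wpM2l ?powR_ge0//.
    rewrite ler_wpM2r ?powR_ge0//.
    by apply: (ge0_ler_powR (ltW d0)); rewrite ?nnegrE ?(ltW Rx) ?(ltW r1) ?Rxr.
  have Rd : Rr `^ delta * Rr `^ (- delta) = 1.
    by rewrite powRN mulfV// lt0r_neq0// powR_gt0.
  have gA2 : K * (g x * B x) <= p * (eps `^ (p - 1) * A `^ (p - 1)) * `|B x|.
    apply: (le_trans (ler_wpM2l K0 gA)).
    have -> : K * (C * Rr `^ (- delta) * A `^ (p - 1) * `|B x|) =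
       p * (eps `^ (p - 1) * A `^ (p - 1)) * `|B x| *
        (Rr `^ delta * Rr `^ (- delta)) * (C / C) by rewrite /K; ring.
    by rewrite Rd divff ?lt0r_neq0// !mulr1.
  (* The weight cancels all but one power of [1 + Rr x]; the remaining one integrates to a
     logarithm. *)
  have wA : A `^ p * cwgt nu x <= Rr `^ (- (2 * nu + 1)) * (1 + Rr * x)^-1.
    have -> : A `^ p = (1 + Rr * x) `^ (- (2 * nu + 1)) * (1 + Rr * x)^-1.
      rewrite Ap -[(1 + Rr * x)^-1](powR_inv1 (ltW r1)) -powRD ?r1n ?implybT//.
      by congr powR; ring.
    have -> : cwgt nu x = Rr `^ (- (2 * nu + 1)) * (Rr * x) `^ (2 * nu + 1).
      rewrite powRM ?(ltW Rr0) ?(ltW x0)// mulrA powRN mulVf ?mul1r.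
        by rewrite cwgtE.
      by rewrite lt0r_neq0// powR_gt0.
    rewrite mulrCA ler_wpM2l ?powR_ge0// mulrAC ler_piMl ?invr_ge0 ?(ltW r1)//.
    rewrite powRN mulrC ler_pdivrMr ?powR_gt0// mul1r.
    by apply: (ge0_ler_powR k0); rewrite ?nnegrE ?(ltW Rx) ?(ltW r1) ?Rxr.
  have := ler_wpM2r w0 (le_trans (lerB gA2 (lexx _)) yo).
  apply: le_trans; rewrite mulrBl.
  apply: lerB; first by rewrite le_eqVlt; apply/orP; left; apply/eqP; ring.
  have e0 : 0 <= (p - 1) * eps `^ p by rewrite mulr_ge0 ?powR_ge0// subr_ge0.
  have := ler_wpM2l e0 wA; rewrite /K'.
  by rewrite !mulrA.
have cBg : continuous (fun x : R => B x * (g x * cwgt nu x)).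
  by apply: continuous_mulf => //; apply: continuous_mulf.
have cBp : continuous (fun x : R => `|B x| `^ p * cwgt nu x).
  apply: continuous_mulf => // x.
  apply: (@continuous_comp _ _ _ B (fun t : R => `|t| `^ p)); first exact: cB.
  exact: continuous_normr_powR.
have lower : K * Int (fun x : R => B x * (g x * cwgt nu x)) - K' * (ln (1 + Rr) / Rr)
    <= Int (fun x : R => `|B x| `^ p * cwgt nu x).
  rewrite -(Rintegral_inv1Dx Rr0) -!RintegralZl//; last 2 first.
  - exact: continuous_integrable_oo.
  - exact: continuous_integrable_oo.
  rewrite -RintegralB//; last 2 first.
  - by apply: continuous_integrable_oo; exact: continuous_scalef.
  - by apply: continuous_integrable_oo; exact: continuous_scalef.
  apply: le_Rintegral => //.
  - by apply: continuous_integrable_oo; apply: continuous_subf;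
      exact: continuous_scalef.
  - exact: continuous_integrable_oo.
  by move=> x; rewrite /= in_itv/= => /andP[x0 _]; exact: pointwise.
apply: le_trans lower.
have Rr1 : 1 < Rr by rewrite (lt_le_trans _ Rr2)// ltr1n.
have ln0 : 0 < ln Rr by exact: ln_gt0.
have ln2 : ln (1 + Rr) <= 2 * ln Rr.
  have -> : 2 * ln Rr = ln (Rr ^+ 2) by rewrite lnXn// mulr_natl.
  rewrite ler_ln ?posrE ?exprn_gt0 ?addr_gt0// (@le_trans _ _ (2 * Rr))//.
    by rewrite mulr_natl mulr2n lerD2r ltW.
  by rewrite expr2 ler_wpM2r// ltW.
have Rd : Rr `^ delta * Rr `^ (- delta) = 1.
  by rewrite powRN mulfV// lt0r_neq0// powR_gt0.
have t1 : eps `^ (p - 1) * D * (ln Rr * mass nu eta) <=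
    K * Int (fun x : R => B x * (g x * cwgt nu x)).
  apply: le_trans (ler_wpM2l K0 hB).
  have -> : K * (c1 * ln Rr * Rr `^ (- delta) * q) =
    eps `^ (p - 1) * (p * c1 * jb nu 0 / (2 * C)) * (ln Rr * mass nu eta) *
    (Rr `^ delta * Rr `^ (- delta)) by rewrite /K /q; field; exact: lt0r_neq0.
  by rewrite Rd mulr1.
have t2 : K' * (ln (1 + Rr) / Rr) <=
    eps `^ (p - 1) * (D / 2) * (ln Rr * mass nu eta).
  apply: (@le_trans _ _ (K' * (2 * ln Rr / Rr))).
    by rewrite ler_wpM2l// ler_wpM2r ?invr_ge0// ltW.
  have -> : K' * (2 * ln Rr / Rr) =
     eps `^ (p - 1) * (2 * (p - 1) * eps / kap) * (ln Rr * mass nu eta).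
    have Rm : Rr `^ (- (2 * nu + 2)) = Rr `^ (- (2 * nu + 1)) / Rr.
      rewrite -[Rr^-1](powR_inv1 (ltW Rr0)) -powRD ?(lt0r_neq0 Rr0) ?implybT//.
      by congr powR; ring.
    have ep : eps `^ p = eps `^ (p - 1) * eps.
      by rewrite mulrC mulr_powRB1// ltW.
    rewrite massE Rm /K' ep.
    by field; rewrite !lt0r_neq0.
  apply: ler_wpM2r; first by apply: mulr_ge0; exact: ltW.
  apply: ler_wpM2l; first exact: ltW.
  rewrite /eps.
  have -> : 2 * (p - 1) * (D * kap / (4 * p)) / kap = (D / 2) * ((p - 1) / p).
    by field; rewrite !lt0r_neq0.
  have D2 : 0 <= D / 2 by rewrite divr_ge0// ltW.
  by rewrite -[leRHS]mulr1 ler_wpM2l// ler_pdivrMr// mul1r gerBl.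
apply: le_trans (lerB t1 t2); rewrite le_eqVlt; apply/orP; left; apply/eqP.
by field.
Unshelve. all: by end_near. Qed.

(** * Norms of indicators and passage to the suprema *)

Lemma Lp_nuE p (f g : R -> R) : (forall x, 0 < x < 1 -> f x = g x) ->
  leb.-integrable `]0%R, 1%R[ (EFin \o (fun x : R => `|g x| `^ p * cwgt nu x)) ->
  Lp_nu nu p f = (Int (fun x : R => `|g x| `^ p * cwgt nu x) `^ p^-1)%:E.
Proof.
move=> fg ig; rewrite -poweR_EFin /Lp_nu; congr (_ `^ _)%E.
rewrite /Rintegral fineK; last exact: integrable_fin_num.
apply: eq_integral => x; rewrite inE/= in_itv/= => /andP[x0 x1].
by rewrite fg ?x0// cwgtE.
Qed.

Lemma Lp_nu_indic p k (eta : R) : 0 < p -> 0 <= k -> 0 < eta <= 1 ->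
  Lp_nu nu p (fun x => k * \1_(`]0%R, eta[ : set R) x) =
    ((k `^ p * mass nu eta) `^ p^-1)%:E.
Proof.
move=> p0 k0 eta01.
have e (x : R) : `|k * \1_(`]0%R, eta[ : set R) x| `^ p * cwgt nu x =
    k `^ p * (\1_(`]0%R, eta[ : set R) x * cwgt nu x).
  rewrite indicE; case: (_ \in _); last by rewrite mulr0 normr0 powR0 ?lt0r_neq0// !mul0r mulr0.
  by rewrite mulr1 ger0_norm// mul1r.
have i := @integrable_indic_oo _ _ eta (cwgt_continuous nu_gt).
rewrite (@Lp_nuE _ _ (fun x => k * \1_(`]0%R, eta[ : set R) x))//.
  congr ((_ `^ _)%:E); rewrite -Rintegral_indic_cwgt// -RintegralZl//.
  by apply: eq_Rintegral => x _; rewrite e.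
rewrite (_ : (fun x : R => _) = fun x : R =>
  k `^ p * (\1_(`]0%R, eta[ : set R) x * cwgt nu x)).
  exact: (@integrableZl _ _ _ leb _ _ (k `^ p) (EFin \o _)).
by apply/funext => x; exact: e.
Qed.

Lemma mu_nu_oo (eta : R) : 0 < eta <= 1 ->
  mu_nu nu (`]0%R, eta[ : set R) = (mass nu eta)%:E.
Proof.
move=> /andP[eta0 eta1].
have -> : mass nu eta = \int[leb]_(x in `]0%R, eta[) cwgt nu x.
  rewrite /cwgt Rintegral_normr_powR//; last by have := nu_gt; lra.
  by rewrite /mass (_ : 2 * nu + 1 + 1 = 2 * nu + 2)//; ring.
rewrite /Rintegral fineK; last first.
  apply: integrable_fin_num => //.
  by apply: continuous_integrable_oo; exact: cwgt_continuous.
rewrite /mu_nu (_ : _ `&` _ = (`]0%R, eta[%classic : set R)).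
  apply: eq_integral => x; rewrite inE/= in_itv/= => /andP[x0 _].
  by rewrite cwgtE.
apply/seteqP; split => x /=; rewrite !in_itv/=; first by case.
by move=> /andP[x0 xe]; rewrite x0 xe (lt_le_trans xe).
Qed.

End LowerBound.

Theorem theorem7 (R : realType) (nu delta : R) (s : nat -> R) :
  - (1 / 2) < nu -> bessel_zeros nu s ->
  let p0 := 4 * (nu + 1) / (2 * nu + 3 + 2 * delta) in
  (0 < delta < nu + 1 / 2 ->
   exists C : R, 0 < C /\
     \forall Rr \near +oo%R,
       ((C * ln Rr `^ p0^-1)%:E <=
        ereal_sup [set (Lp_nu nu p0 (bochner_riesz nu s delta Rr \1_E)
                        * ((fine (Lp_nu nu p0 \1_E))^-1)%:E)%E
                  | E in [set E : set R | [/\ measurable E,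
                                             E `<=` `]0%R, 1%R[ &
                                             (0 < mu_nu nu E)%E]]])%E) /\
  (delta = nu + 1 / 2 ->
   exists C : R, 0 < C /\
     \forall Rr \near +oo%R,
       ((C * ln Rr)%:E <=
        ereal_sup [set Lp_nu nu 1 (bochner_riesz nu s delta Rr f)
                  | f in [set f : R -> R | measurable_fun (`]0%R, 1%R[ : set R) f /\
                                           Lp_nu nu 1 f = 1%E]])%E).
Proof.
move=> nu_gt sP p0.
have integrable_pow p (B : R -> R) : 0 < p -> continuous B ->
    (@lebesgue_measure R).-integrable `]0%R, 1%R[
      (EFin \o (fun x : R => `|B x| `^ p * cwgt nu x)).
  move=> pp cB; apply: continuous_integrable_oo.
  apply: continuous_mulf; last exact: cwgt_continuous.
  move=> x; apply: (@continuous_comp _ _ _ B (fun t : R => `|t| `^ p)).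
    exact: cB.
  exact: continuous_normr_powR.
split=> [/andP[d0 dnu]|dE].
  have pp : 0 < p0 by rewrite divr_gt0//; lra.
  have dd : 0 < delta <= nu + 1 / 2 by rewrite d0 ltW.
  have [c c0 H] := bochner_riesz_indic_lower_bound nu_gt sP dd.
  exists (c `^ p0^-1); split; first exact: powR_gt0.
  apply: filterS2 (nbhs_pinfty_gt (num_real 1)) H => Rr Rr1.
  move=> [eta [B [eta01 cB BE hB]]].
  have /andP[eta0 eta1] := eta01.
  have m0 := mass_gt0 nu_gt eta0.
  have ln0 : 0 <= ln Rr by apply: ln_ge0; exact: ltW.
  (* The norm of this indicator is the [1/p0]-th power of its mass, so the ratio is at least
     [(c ln Rr)^(1/p0)]. *)
  pose E : set R := `]0%R, eta[%classic.
  apply: le_ereal_sup_tmp; eexists.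
    exists E; last by [].
    split; [exact: measurable_itv| |by rewrite mu_nu_oo].
    by move=> x; rewrite /E/= !in_itv/= => /andP[-> xe]; rewrite (lt_le_trans xe).
  have EE : (\1_E : R -> R) = (fun x : R => 1 * \1_(`]0%R, eta[ : set R) x).
    by apply/funext => x; rewrite mul1r.
  rewrite [X in fine (Lp_nu _ _ X)]EE Lp_nu_indic// powR1 mul1r [fine _]/=.
  have Bf x : 0 < x < 1 -> bochner_riesz nu s delta Rr \1_E x = B x.
    by move=> /andP[x0 _]; rewrite EE BE// mul1r.
  rewrite (Lp_nuE Bf (integrable_pow _ _ pp cB)).
  rewrite -EFinM lee_fin ler_pdivlMr ?powR_gt0//.
  have cl : 0 <= c * ln Rr by rewrite mulr_ge0// ltW.
  rewrite -powRM ?(ltW c0)// -powRM ?(ltW m0)//.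
  have ip : 0 <= p0^-1 by rewrite invr_ge0 ltW.
  apply: (ge0_ler_powR ip) => //; rewrite nnegrE.
    by rewrite mulr_ge0// ltW.
  by apply: Rintegral_ge0 => x _; rewrite mulr_ge0 ?powR_ge0.
have p1 : p0 = 1 by rewrite /p0 dE; field; lra.
have dd : 0 < delta <= nu + 1 / 2 by rewrite dE lexx andbT; lra.
have [c c0 H] := bochner_riesz_indic_lower_bound nu_gt sP dd.
exists c; split => //.
apply: filterS2 (nbhs_pinfty_gt (num_real 1)) H => Rr Rr1.
move=> [eta [B [eta01 cB BE hB]]].
have /andP[eta0 eta1] := eta01.
have m0 := mass_gt0 nu_gt eta0.
(* Dividing the indicator by its mass gives it [L^1] norm [1]. *)
pose k := (mass nu eta)^-1.
have k0 : 0 < k by rewrite invr_gt0.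
have iB1 : (@lebesgue_measure R).-integrable `]0%R, 1%R[
    (EFin \o (fun x : R => `|B x| `^ 1 * cwgt nu x)) by exact: integrable_pow.
apply: le_ereal_sup_tmp; eexists.
  exists (fun x => k * \1_(`]0%R, eta[ : set R) x); last by [].
  split.
    apply: measurable_funM; first exact: measurable_cst.
    exact: measurable_indic.
  rewrite Lp_nu_indic ?(ltW k0)// powRr1 ?(ltW k0)// /k mulVf ?lt0r_neq0//.
  by rewrite powR1.
have Bf x : 0 < x < 1 -> bochner_riesz nu s delta Rr
    (fun x => k * \1_(`]0%R, eta[ : set R) x) x = k * B x.
  by move=> /andP[x0 _]; rewrite BE.
rewrite (Lp_nuE Bf (integrable_pow _ _ ltr01 (continuous_scalef (c := k) cB))).
rewrite invr1 powRr1; last first.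
  by apply: Rintegral_ge0 => x _; rewrite mulr_ge0 ?powR_ge0.
rewrite lee_fin.
have -> : \int[lebesgue_measure]_(x in `]0%R, 1%R[) (`|k * B x| `^ 1 * cwgt nu x)
    = k * \int[lebesgue_measure]_(x in `]0%R, 1%R[) (`|B x| `^ 1 * cwgt nu x).
  rewrite -RintegralZl//; apply: eq_Rintegral => x _.
  by rewrite !powRr1// normrM (gtr0_norm k0) mulrA.
rewrite [k * _]mulrC /k ler_pdivlMr//.
by rewrite -/p0 p1 in hB.
Qed.
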